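(* Let $f\in R_1=\mathbb{Z}[z^{\pm1}]$ be nonzero with $\mathsf{m}(f)>0$. Then the principal algebraic $\mathbb{Z}$-action $(X_f,\alpha_f)$ is Bohr chaotic.
   Context: $\mathbb{N}=\{0,1,2,\dots\}$ and $\mathbb{T}=\mathbb{R}/\mathbb{Z}$. Principal algebraic $\mathbb{Z}$-action: for a nonzero $f=\sum_{n\in\mathbb{Z}}f_nz^n\in R_1$ (finitely many nonzero integer coefficients), put $X_f=\{x=(x_n)\in\mathbb{T}^{\mathbb{Z}} : \sum_{m\in\mathbb{Z}}f_mx_{n+m}=0 \text{ in }\mathbb{T}\text{ for all }n\in\mathbb{Z}\}$, a compact group, and let $\alpha_f$ be the restriction to $X_f$ of the shift action $(\sigma^mx)_n=x_{n+m}$ of $\mathbb{Z}$ on $\mathbb{T}^{\mathbb{Z}}$. Mahler measure: $\mathsf{m}(f)=\int_0^1\log|f(e^{2\pi it})|\,dt$. Bohr chaoticity: a non-trivial weight is a bounded complex sequence $w=(w_n)_{n\in\mathbb{N}}$ with $\limsup_{N\to\infty}\frac1N\sum_{n=0}^{N-1}|w_n|>0$. A continuous $\mathbb{Z}$-action $\alpha$ on a compact space $X$ is Bohr chaotic if for every non-trivial weight $w$ there exist $g\in C(X)$ and $x\in X$ with $\limsup_{N\to\infty}\frac1N\bigl|\sum_{n=0}^{N-1}w_n\,g(\alpha^nx)\bigr|>0$. *)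

(* Defs.v *)
From HB Require Import structures.
From mathcomp Require Import all_boot all_order all_algebra.
From mathcomp Require Import finmap.
From mathcomp Require Import generic_quotient ring_quotient.
From mathcomp Require Import all_classical all_reals all_analysis.
From mathcomp Require Import complex.

Set Implicit Arguments.
Unset Strict Implicit.
Unset Printing Implicit Defensive.

Import Order.TTheory GRing.Theory Num.Theory.
Import numFieldNormedType.Exports.

Local Open Scope classical_set_scope.
Local Open Scope ring_scope.
Local Open Scope quotient_scope.

Definition int_subgroup (R : realType) : zmodClosed R :=
  GRing.ZmodClosed.clone R (@Num.int_num_subdef R) _.

Definition circle (R : realType) : Type :=
  quotient_topology (Quotient.quot (int_subgroup R)).

HB.instance Definition _ (R : realType) := Topological.on (circle R).
HB.instance Definition _ (R : realType) := Quotient.on (circle R).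
HB.instance Definition _ (R : realType) := GRing.isZmodule.Build (circle R)
  (@Quotient.addqA R (int_subgroup R)) (@Quotient.addqC R (int_subgroup R))
  (@Quotient.add0q R (int_subgroup R)) (@Quotient.addNq R (int_subgroup R)).

Section topological_zmodule.
Variables (X : topologicalType) (M : topologicalZmodType).
Implicit Types g h : X -> M.

Lemma continuousD_top g h x : continuous_at x g -> continuous_at x h ->
  continuous_at x (fun y => g y + h y).
Proof.
move=> cg ch; apply: (@continuous_comp _ _ _ (fun y => (g y, h y))
  (fun z : M * M => z.1 + z.2)); last exact: add_continuous.
exact: cvg_pair.
Qed.

Lemma continuousMz_top g (k : int) x : continuous_at x g ->
  continuous_at x (fun y => g y *~ k).
Proof.
move=> cg.
have cn n : continuous_at x (fun y => g y *+ n).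
  elim: n => [|n IH]; first exact: cvg_cst.
  have -> : (fun y => g y *+ n.+1) = (fun y => g y + g y *+ n).
    by apply/funext => y; rewrite mulrS.
  exact: continuousD_top.
case: k => n; first exact: cn.
apply: (@continuous_comp _ _ _ (fun y => g y *+ n.+1) -%R); first exact: cn.
exact: opp_continuous.
Qed.

Lemma continuous_sum_top (I : Type) (s : seq I) (g : I -> X -> M) x :
  (forall i, continuous_at x (g i)) ->
  continuous_at x (fun y => \sum_(i <- s) g i y).
Proof.
move=> cg; elim: s => [|i s IH].
  have -> : (fun y => \sum_(i <- [::]) g i y) = (fun=> 0).
    by apply/funext => y; rewrite big_nil.
  exact: cvg_cst.
have -> : (fun y => \sum_(j <- i :: s) g j y) =
    (fun y => g i y + \sum_(j <- s) g j y).
  by apply/funext => y; rewrite big_cons.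
exact: continuousD_top.
Qed.

End topological_zmodule.

Section circle_theory.
Variable R : realType.
Local Notation T := (circle R).

Lemma circle_piB (a b : R) : \pi_T (a - b) = \pi_T a - \pi_T b :> T.
Proof.
by rewrite -[- \pi_T b]Quotient.pi_opp; exact: Quotient.pi_add.
Qed.

Lemma circle_pi_eq (a b : R) :
  \pi_T a = \pi_T b :> T <-> a - b \is a Num.int.
Proof.
rewrite -[a - b \is a _]/(a - b \in int_subgroup R) Quotient.idealrBE.
by split=> [|/eqP] ab; [apply/eqP|]; exact: ab.
Qed.

Lemma circle_pi_continuous : continuous (\pi_T : R -> T).
Proof. exact: pi_continuous. Qed.

Lemma circle_pi_open (A : set R) : open A -> open [set \pi_T a | a in A].
Proof.
move=> oA; rewrite /open/= /quotient_open.
have -> : \pi_T @^-1` [set \pi_T a | a in A] =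
    \bigcup_(n : int) ((fun t : R => t - n%:~R) @^-1` A).
  apply/seteqP; split => [t /= [a Aa /esym/circle_pi_eq/intrP[n tan]]|t /= [n _ /= An]].
    by exists n => //=; rewrite -tan opprB addrC subrK.
  exists (t - n%:~R) => //; apply/circle_pi_eq.
  by rewrite addrAC subrr add0r rpredN intr_int.
apply: bigcup_open => n _; apply: open_comp => // t _.
by apply: continuousB; [exact: cvg_id|exact: cvg_cst].
Qed.

Lemma circle_sub_continuous : continuous (fun x : T * T => x.1 - x.2).
Proof.
case=> x y U /= nU.
have : nbhs (repr x, repr y) [set ab : R * R | U (\pi_T (ab.1 - ab.2))].
  have : nbhs (repr x - repr y : R) (\pi_T @^-1` U).
    by apply: circle_pi_continuous; rewrite circle_piB !reprK.
  exact: (@sub_continuous R (repr x, repr y)).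
case=> -[A B] /= [nA nB] AB.
have nbhs_pi (z : T) (C : set R) : nbhs (repr z) C -> nbhs z (\pi_T @` C).
  rewrite nbhsE => -[D [oD Dz] DC]; rewrite nbhsE.
  exists (\pi_T @` D); last exact: image_subset.
  by split; [exact: circle_pi_open|exists (repr z); rewrite ?reprK].
exists (\pi_T @` A, \pi_T @` B); first by split; exact: nbhs_pi.
move=> [_ _] /= [[a Aa <-] [b Bb <-]].
by have := AB (a, b) (conj Aa Bb); rewrite /= circle_piB.
Qed.

HB.instance Definition _ :=
  PreTopologicalNmodule_isTopologicalZmodule.Build T circle_sub_continuous.

Lemma circle_compact : compact [set: T].
Proof.
have -> : [set: T] = \pi_T @` `[0, 1]%classic.
  apply/seteqP; split => // x _; exists (repr x - (Num.floor (repr x))%:~R).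
    rewrite /= in_itv/= subr_ge0 floor_le/=.
    by rewrite lerBlDl ltW// (lt_le_trans (floorD1_gt _))// intrD addrC.
  rewrite -[RHS]reprK; apply/circle_pi_eq.
  by rewrite addrAC subrr add0r rpredN intr_int.
apply: continuous_compact; last exact: segment_compact.
by apply: continuous_subspaceT; exact: circle_pi_continuous.
Qed.

Lemma circle_closed0 : closed [set (0 : T)].
Proof.
rewrite -openC /open/= /quotient_open.
have -> : \pi_T @^-1` (~` [set (0 : T)]) =
    \bigcup_(n : int) (`]n%:~R, (n + 1)%:~R[%classic : set R).
  have pi0 : (0 : T) = \pi_T 0 by rewrite -(subrr (0 : R)) circle_piB subrr.
  apply/seteqP; split => [t /= t0|t /= [n _ /=]].
    exists (Num.floor t) => //=; rewrite in_itv/= floorD1_gt andbT.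
    rewrite lt_neqAle floor_le andbT -intrEfloor; apply/negP => ti.
    by apply: t0; rewrite pi0; apply/circle_pi_eq; rewrite subr0.
  rewrite in_itv/= => /andP[nt tn] /=; rewrite pi0 => /circle_pi_eq.
  rewrite subr0 => /intrP[m tm]; move: nt tn; rewrite tm !ltr_int ltzD1.
  by move=> nm /(lt_le_trans nm); rewrite ltxx.
by apply: bigcup_open => n _; exact: interval_open.
Qed.

End circle_theory.

Record compact_zaction := CompactZaction {
  phase :> topologicalType;
  zact : int -> phase -> phase;
  phase_compact : compact [set: phase];
  zact_continuous : forall m, continuous (zact m);
  zact0 : forall x, zact 0 x = x;
  zactD : forall m n x, zact (m + n) x = zact m (zact n x)
}.

Section bohr_chaotic.
Variable R : realType.
Local Notation normc := (@ComplexField.Normc.normc R).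

(* The term N = 0 is harmless: it is 0, and limsup ignores it. *)
Definition cesaro_limsup (u : nat -> R) : \bar R :=
  limn_esup (fun N => (N%:R^-1 * u N)%:E).

Definition nontrivial_weight (w : nat -> R[i]) : Prop :=
  (exists M : R, forall n, normc (w n) <= M) /\
  (0 < cesaro_limsup (fun N => (\sum_(n < N) normc (w n))%R))%E.

(* R[i]^o carries the topology of the modulus, so that C(X) is the space of
   complex-valued continuous functions. *)
Definition bohr_chaotic (S : compact_zaction) : Prop :=
  forall w : nat -> R[i], nontrivial_weight w ->
    exists (g : S -> R[i]^o) (x : S), continuous g /\
      (0 < cesaro_limsup
         (fun N => normc (\sum_(n < N) w n * g (zact n%:Z x))%R))%E.

End bohr_chaotic.

(* Elements of Z[z, 1/z], as their finitely supported coefficient families. *)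
Notation laurent := {fsfun int -> int with 0}.

Section principal.
Variables (R : realType) (f : laurent).

Definition laurent_eval (z : R[i]) : R[i] :=
  \sum_(m <- finsupp f) (f m)%:~R * z ^ m.

(* lne 0 = -oo, as in the convention log 0 = -oo. *)
Definition mahler_measure : \bar R :=
  \int[lebesgue_measure]_(t in `[0%R, 1%R])
    lne (ComplexField.Normc.normc (laurent_eval
      (Complex (cos (2 * pi * t)) (sin (2 * pi * t)))))%:E.

Definition principal_set : set {ptws int -> circle R} :=
  [set x | forall n : int, \sum_(m <- finsupp f) x (n + m) *~ f m = 0].

Lemma shift_subproof (m : int) (x : principal_set) :
  (fun n : int => set_val x (n + m)) \in principal_set.
Proof.
apply/mem_set => n; have /set_mem/(_ (n + m)) := valP x.
by under eq_bigr do rewrite addrAC.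
Qed.

Definition principal_shift (m : int) (x : principal_set) : principal_set :=
  exist (fun y => y \in principal_set) _ (shift_subproof m x).

Lemma principal_shift0 x : principal_shift 0 x = x.
Proof. by apply/val_inj/funext => n /=; rewrite addr0. Qed.

Lemma principal_shiftD m n x :
  principal_shift (m + n) x = principal_shift m (principal_shift n x).
Proof. by apply/val_inj/funext => k /=; rewrite addrA. Qed.

Lemma coord_continuous (n : int) :
  continuous (fun x : {ptws int -> circle R} => x n).
Proof. exact: (@proj_continuous int (fun=> circle R) n). Qed.

Lemma principal_shift_continuous m : continuous (principal_shift m).
Proof.
apply: continuous_comp_initial => x; apply/(@cvg_sup _ _ _ _ _ (fmap_filter _ (nbhs_filter x))) => n.
apply: continuous_comp_initial => {}x.
apply: (@continuous_comp _ _ _ set_val (fun y : {ptws int -> circle R} => y (n + m))).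
  exact: initial_continuous.
exact: coord_continuous.
Qed.

Lemma principal_set_closed : closed principal_set.
Proof.
have -> : principal_set = \bigcap_n
    (fun x : {ptws int -> circle R} =>
       \sum_(m <- finsupp f) x (n + m) *~ f m) @^-1` [set 0].
  by apply/seteqP; split => x /= h n; [move=> _|]; exact: h.
apply: closed_bigI => n _; apply: preimage_closed => [x _|];
  last exact: circle_closed0.
apply: continuous_sum_top => m; apply: continuousMz_top.
exact: coord_continuous.
Qed.

Lemma principal_compact : compact [set: principal_set].
Proof.
have cX : compact principal_set.
  apply: (subclosed_compact principal_set_closed
    (@tychonoff int (fun=> circle R) (fun=> setT) (fun=> @circle_compact R))).
  by move=> x _ i.
move=> F PF _; have FX : F (set_val @^-1` principal_set).
  by apply: filterS filterT => x _; have /set_mem := valP x.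
have [p [Xp clp]] := cX (set_val @ F) _ FX.
exists (exist (fun y => y \in principal_set) p (mem_set Xp)); split => //.
move=> A B FA [_ [[W oW <-] /= Wp WB]].
have FA' : F (set_val @^-1` (set_val @` A)).
  by apply: filterS FA => y Ay; exists y.
have [_ [[y Ay <-] Wy]] := clp _ W FA' (open_nbhs_nbhs (conj oW Wp)).
by exists y; split => //; exact: WB.
Qed.

Definition principal_action : compact_zaction :=
  CompactZaction principal_compact principal_shift_continuous
    principal_shift0 principal_shiftD.

End principal.

(* Main.v *)
(* Put e(u) = exp(2 pi i u).  The test function is always g(x) = e(x_0), so one needs a
   solution x modulo 1 of the recurrence with coefficients f whose phases follow those of the
   weight w.  By Jensen's formula, m(f) > 0 forces a root lambda of f with |lambda| > 1 or a
   leading coefficient of absolute value q >= 2.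

   If |lambda| > 1, take x_n = Re(t lambda^n) with t complex.  For k large the frequencies
   lambda^(m + k j) are so lacunary that the Riesz product prod_j (1 + cos(2 pi Re(t
   lambda^(m + k j)) + phase)), averaged over any small square of values of t, correlates
   with the waves at the times m + k j and is nearly orthogonal to those at all other times.
   Hence, for every N_0, the t with a large N-th correlation average for some N >= N_0 form
   a dense open set, and Baire's theorem gives one t that works for infinitely many N.

   If q >= 2, let x_n = 0 for n < 0; each later x_n is determined only up to multiples of 1/q.
   For q >= 3 one of these values has phase within pi/3 of the wanted one at every time.  For
   q = 2 the two choices have opposite correlations with w, which fails only when the
   correlation is purely imaginary.  If f is even, x_n in {0, 1/2} and the real or the
   imaginary part works.  Otherwise, for the least l such that the l-th coefficient from the
   top is odd, the choice at time n turns the phase at time n + l by a right angle, so that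
   choices in one half of the time produce a gain in the other half. *)

From Pilot Require Import Defs.
From HB Require Import structures.
From mathcomp Require Import all_boot all_order all_algebra.
From mathcomp Require Import finmap.
From mathcomp Require Import generic_quotient.
From mathcomp Require Import all_classical all_reals all_analysis.
From mathcomp Require Import measurable_realfun complex.
From mathcomp Require Import zify ring lra.

Set Implicit Arguments.
Unset Strict Implicit.
Unset Printing Implicit Defensive.

Import Order.TTheory GRing.Theory Num.Theory.
Import numFieldNormedType.Exports.

Local Open Scope complex_scope.
Local Open Scope ring_scope.

Notation normc := ComplexField.Normc.normc.

(** * Riesz products over an expanding root *)

Section trigonometry.
Variable R : realType.
Implicit Types (x y : R) (z : R[i]).

Lemma cos_mul_cos x y : cos x * cos y = (cos (x + y) + cos (x - y)) / 2.
Proof. by rewrite cosD cosB; lra. Qed.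

Lemma sin_ge_linear x : `|x| <= 1 -> cos 1 * `|x| <= `|sin x|.
Proof.
wlog x0 : x / 0 <= x => [H|].
  have [/H//|/ltW x0] := leP 0 x => x1.
  by rewrite -(normrN x) -(normrN (sin x)) -sinN; apply: H; rewrite ?normrN// oppr_ge0.
rewrite (ger0_norm x0) => x1.
move: x0; rewrite le_eqVlt => /predU1P[<-|x0]; first by rewrite mulr0.
have cs : {within `[0, x], continuous (@sin R)}%classic.
  by apply: continuous_subspaceT => y; exact: continuous_sin.
have ds y : y \in `]0, x[%R -> is_derive y 1 (@sin R) (cos y).
  by move=> _; exact: is_derive_sin.
have [y /itvP y0x] := MVT x0 ds cs.
rewrite sin0 !subr0 => ->.
apply: le_trans (ler_norm _); apply: ler_wpM2r; first exact: ltW.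
have pi1 : 1 <= pi :> R by apply: le_trans (pi_ge2 R); rewrite ler1n.
have y1 : y <= 1 by apply: le_trans x1; rewrite y0x.
rewrite leNgt ltr_cos ?in_itv /=; first by rewrite -leNgt.
- by rewrite ler01.
- by rewrite y0x/= (le_trans y1).
Qed.

(** Multiplication by [2 sin (b / 2)] makes the sum telescope, as for the Dirichlet kernel. *)
Lemma geometric_cos_sum (a b : R) (G : nat) :
  `|\sum_(j < G) cos (a + j%:R * b)| * `|sin (b / 2)| <= 1.
Proof.
suff : `|(\sum_(j < G) cos (a + j%:R * b)) * sin (b / 2) * 2| <= 2.
  by rewrite !normrM (ger0_norm (ler0n _ 2)); lra.
have -> : (\sum_(j < G) cos (a + j%:R * b)) * sin (b / 2) * 2 =
  sin (a + G%:R * b - b / 2) - sin (a - b / 2).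
  elim: G => [|G IH]; first by rewrite big_ord0 !mul0r addr0 subrr.
  rewrite big_ord_recr /= mulrDl mulrDl IH.
  have -> : a + G.+1%:R * b - b / 2 = (a + G%:R * b) + b / 2.
    by rewrite -natr1; lra.
  by rewrite [sin (a + G%:R * b + b / 2)]sinD [sin (a + G%:R * b - b / 2)]sinB; ring.
by apply: le_trans (ler_normB _ _) _; rewrite -[leRHS]/(1 + 1) lerD ?sin_max.
Qed.

Lemma geometric_cos_mean (a b : R) (G : nat) : (0 < G)%N -> b != 0 -> `|b| <= 2 ->
  `|\sum_(j < G) cos (a + j%:R * b)| <= 2 / (cos 1 * `|b|).
Proof.
move=> G0 b0 b2.
have c1 := @cos1_gt0 R.
have nb : 0 < `|b| by rewrite normr_gt0.
rewrite ler_pdivlMr ?mulr_gt0//.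
have b21 : `|b / 2| <= 1.
  by rewrite normrM normfV ler_pdivrMr ?mul1r ?normr_gt0// (ger0_norm (ler0n _ 2)).
have := sin_ge_linear b21.
rewrite normrM normfV (ger0_norm (ler0n _ 2)) => sb.
have := geometric_cos_sum a b G.
set S := `| \sum_(_ < _) _|; move=> H.
have S0 : 0 <= S by exact: normr_ge0.
have := ler_wpM2l S0 sb; lra.
Qed.

Lemma normc_ge0 z : 0 <= normc z.
Proof. by case: z => a b; exact: sqrtr_ge0. Qed.

Lemma ler_normcD z z' : normc (z + z') <= normc z + normc z'.
Proof. exact: (@le_normcD R). Qed.

Lemma normc_opp z : normc (- z) = normc z.
Proof. exact: (@normcN R). Qed.

Lemma ler_normcB z z' : normc z - normc z' <= normc (z - z').
Proof. by rewrite lerBlDr -{1}(subrK z' z) ler_normcD. Qed.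

Lemma normc_exp z n : normc (z ^+ n) = normc z ^+ n.
Proof.
by elim: n => [|n IH]; rewrite ?ComplexField.Normc.normc1// !exprS
  ComplexField.Normc.normcM IH.
Qed.

Lemma Re_le_normc z : `|complex.Re z| <= normc z.
Proof.
by case: z => a b /=; rewrite -sqrtr_sqr ler_wsqrtr// lerDl sqr_ge0.
Qed.

Lemma Im_le_normc z : `|complex.Im z| <= normc z.
Proof.
by case: z => a b /=; rewrite -sqrtr_sqr ler_wsqrtr// lerDr sqr_ge0.
Qed.

Lemma normc_le_sum z : normc z <= `|complex.Re z| + `|complex.Im z|.
Proof.
case: z => a b /=; rewrite -(@ger0_norm _ (`|a| + `|b|)) ?addr_ge0//.
rewrite -sqrtr_sqr ler_wsqrtr// sqrrD !real_normK ?num_real//.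
by rewrite addrAC lerDl mulrn_wge0 ?mulr_ge0.
Qed.

End trigonometry.

(** * Plane waves and their means over square grids *)

Section wave.
Variable R : realType.
Implicit Types (z : R[i]) (t : R * R).

(* [wave z phi t = cos (2 pi Re (z t) + phi)] for [t] read as a complex number. *)
Definition wave z (phi : R) t : R :=
  cos (2 * pi * (complex.Re z * t.1 - complex.Im z * t.2) + phi).

Lemma wave00 t : wave 0 0 t = 1.
Proof. by rewrite /wave /= !mul0r subrr mulr0 addr0 cos0. Qed.

Lemma waveM z z' p p' t : wave z p t * wave z' p' t =
  (wave (z + z') (p + p') t + wave (z - z') (p - p') t) / 2.
Proof.
case: z => a b; case: z' => a' b'; rewrite /wave /= cos_mul_cos.
by congr ((cos _ + cos _) / 2); ring.
Qed.

Lemma wave_le1 z p t : `|wave z p t| <= 1. Proof. exact: cos_max. Qed.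

(** Means over this grid stand in for integrals over a square of side [h], so that averages of Riesz
    products are finite sums. *)
Definition gridpt (t0 : R * R) (h : R) G (j : 'I_G * 'I_G) : R * R :=
  (t0.1 + j.1%:R * (h / G%:R), t0.2 + j.2%:R * (h / G%:R)).

Definition mean (I : finType) (p : I -> R * R) (F : R * R -> R) : R :=
  #|I|%:R^-1 * \sum_i F (p i).

(** The last hypothesis says that the phase moves by at most 2 between neighbouring grid points, so
    the grid does not alias the frequency [z]. The geometric sum is taken along an axis on which [z]
    has a component of size at least [normc z / 2]. *)
Lemma mean_wave_grid t0 (h : R) G z phi : 0 < h -> (0 < G)%N -> z != 0 ->
  2 * pi * normc z * h <= 2 * G%:R ->
  `|mean (@gridpt t0 h G) (wave z phi)| <= 2 / (cos 1 * pi * h) / normc z.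
Proof.
move=> h0 G0 z0 zG.
have pi0 := pi_gt0 R; have c1 := @cos1_gt0 R.
have GR : 0 < G%:R :> R by rewrite ltr0n.
have nz : 0 < normc z.
  by rewrite lt_neqAle normc_ge0 andbT eq_sym; apply: contra z0 => /eqP/ComplexField.Normc.eq0_normc->.
have key (a : R) : normc z / 2 <= `|a| -> `|a| <= normc z -> forall b : R,
    `|\sum_(j < G) cos (b + j%:R * (2 * pi * a * (h / G%:R)))| <=
    G%:R * (2 / (cos 1 * pi * h) / normc z).
  move=> a1 a2 b.
  have a0 : 0 < `|a| by apply: lt_le_trans a1; rewrite divr_gt0.
  have nE : `|2 * pi * a * (h / G%:R)| = 2 * pi * `|a| * (h / G%:R).
    by rewrite !normrM normfV (ger0_norm (ler0n _ 2)) (gtr0_norm pi0) (gtr0_norm h0) (gtr0_norm GR).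
  apply: le_trans (geometric_cos_mean _ G0 _ _) _.
  - by rewrite -normr_gt0 nE !mulr_gt0 ?invr_gt0.
  - rewrite nE mulrA ler_pdivrMr//; apply: le_trans zG.
    by rewrite ler_wpM2r ?(ltW h0)// ler_wpM2l// mulr_ge0// ltW.
  rewrite nE.
  have fieldE (c p x y g : R) : c != 0 -> p != 0 -> x != 0 -> y != 0 -> g != 0 ->
      2 / (c * (2 * p * x * (y / g))) = g * (2 / (c * p * y) / (2 * x)).
    by move=> *; field; do ?[apply/andP; split].
  rewrite fieldE ?gt_eqF//.
  rewrite ler_pM2l//; apply: ler_wpM2l; first by rewrite divr_ge0 ?mulr_ge0 ?ltW.
  by rewrite lef_pV2 ?posrE ?mulr_gt0//; lra.
rewrite /mean normrM normfV normr_nat card_prod card_ord.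
rewrite ler_pdivrMl ?ltr0n ?muln_gt0 ?G0//.
have -> : \sum_(i : 'I_G * 'I_G) wave z phi (@gridpt t0 h G i) =
   \sum_(i < G) \sum_(j < G) wave z phi (@gridpt t0 h G (i, j)).
  by rewrite pair_bigA; apply: eq_bigr => -[? ?].
have [a1|a1] := leP (normc z / 2) `|complex.Im z|.
  apply: le_trans (ler_norm_sum _ _ _) _.
  have -> : (G * G)%:R * (2 / (cos 1 * pi * h) / normc z) =
     \sum_(i < G) G%:R * (2 / (cos 1 * pi * h) / normc z).
    by rewrite sumr_const card_ord -[RHS]mulr_natl natrM -mulrA.
  apply: ler_sum => i _.
  set b := 2 * pi * (complex.Re z * (t0.1 + i%:R * (h / G%:R)) - complex.Im z * t0.2) + phi.
  have := key (- complex.Im z); rewrite normrN => /(_ a1 (Im_le_normc _) b).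
  apply: le_trans; rewrite le_eqVlt; apply/orP; left; apply/eqP; congr `|_|.
  by apply: eq_bigr => j _; rewrite /wave /b /=; congr cos; ring.
have a2 : normc z / 2 <= `|complex.Re z|.
  by have := normc_le_sum z; lra.
rewrite exchange_big /=.
apply: le_trans (ler_norm_sum _ _ _) _.
have -> : (G * G)%:R * (2 / (cos 1 * pi * h) / normc z) =
   \sum_(i < G) G%:R * (2 / (cos 1 * pi * h) / normc z).
  by rewrite sumr_const card_ord -[RHS]mulr_natl natrM -mulrA.
apply: ler_sum => i _.
set b := 2 * pi * (complex.Re z * t0.1 - complex.Im z * (t0.2 + i%:R * (h / G%:R))) + phi.
have := key (complex.Re z) a2 (Re_le_normc _) b.
apply: le_trans; rewrite le_eqVlt; apply/orP; left; apply/eqP; congr `|_|.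
by apply: eq_bigr => j _; rewrite /wave /b /=; congr cos; ring.
Qed.

End wave.

(** * Means of Riesz products under decay of the means of waves *)

Section riesz.
Variable R : realType.
Variables (I : finType) (p : I -> R * R).
Implicit Types (F H : R * R -> R) (z : R[i]).
Local Notation J := (mean p).

Lemma eq_mean F H : F =1 H -> J F = J H.
Proof. by move=> FH; congr (_ * _); apply: eq_bigr => i _; exact: FH. Qed.

Lemma meanD F H : J (fun t => F t + H t) = J F + J H.
Proof. by rewrite /mean big_split mulrDr. Qed.

Lemma meanZ (c : R) F : J (fun t => c * F t) = c * J F.
Proof. by rewrite /mean -mulr_sumr mulrCA. Qed.

Lemma mean_sum n (F : nat -> R * R -> R) :
  J (fun t => \sum_(i < n) F i t) = \sum_(i < n) J (F i).
Proof. by rewrite /mean exchange_big mulr_sumr. Qed.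

Lemma le_mean F H : (forall t, F t <= H t) -> J F <= J H.
Proof.
by move=> FH; rewrite ler_wpM2l ?invr_ge0 ?ler0n//; apply: ler_sum => i _.
Qed.

Hypothesis I0 : (0 < #|I|)%N.

Lemma mean1 : J (fun=> 1) = 1.
Proof.
by rewrite /mean sumr_const mulVf// pnatr_eq0 -lt0n.
Qed.

Variables (B Xi : R) (z_ : nat -> R[i]) (psi_ : nat -> R).
Hypothesis B0 : 0 <= B.
(** The only analytic input about the points [p]; for a grid it holds up to a frequency [Xi] that
    grows with the number of points. *)
Hypothesis J_wave : forall z phi, 0 < normc z -> normc z <= Xi ->
  `|J (wave z phi)| <= B / normc z.

Local Notation ell i := (normc (z_ i)).
Local Notation Lam n := (\sum_(i < n) ell i).

Definition riesz_prod n t : R := \prod_(i < n) (1 + wave (z_ i) (psi_ i) t).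

Lemma riesz_prod_ge0 n t : 0 <= riesz_prod n t.
Proof.
apply: prodr_ge0 => i _; have := wave_le1 (z_ i) (psi_ i) t.
by rewrite ler_norml => /andP[]; lra.
Qed.

Lemma riesz_prodS n t :
  riesz_prod n.+1 t = riesz_prod n t + riesz_prod n t * wave (z_ n) (psi_ n) t.
Proof. by rewrite /riesz_prod big_ord_recr /= mulrDr mulr1. Qed.

Lemma Lam_ge0 n : 0 <= Lam n.
Proof. by apply: sumr_ge0 => i _; exact: normc_ge0. Qed.

Lemma mean_rieszM n z phi z' phi' :
  J (fun t => riesz_prod n t * wave z phi t * wave z' phi' t) =
  (J (fun t => riesz_prod n t * wave (z + z') (phi + phi') t) +
   J (fun t => riesz_prod n t * wave (z - z') (phi - phi') t)) / 2.
Proof.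
rewrite -meanD mulrC -meanZ; apply: eq_mean => t.
by rewrite -mulrA waveM; lra.
Qed.

Lemma mean_rieszS n z phi :
  J (fun t => riesz_prod n.+1 t * wave z phi t) =
  J (fun t => riesz_prod n t * wave z phi t) +
  J (fun t => riesz_prod n t * wave (z_ n) (psi_ n) t * wave z phi t).
Proof.
by rewrite -meanD; apply: eq_mean => t; rewrite riesz_prodS mulrDl.
Qed.

(* The frequencies of [riesz_prod n] are the sums of [eps_i z_i] with [eps_i]
   in {-1, 0, 1}; those of the integrand stay at distance [D] from 0. *)
Lemma mean_riesz_far n z phi (D : R) : 0 < D -> D + Lam n <= normc z ->
  normc z + Lam n <= Xi ->
  `|J (fun t => riesz_prod n t * wave z phi t)| <= 2 ^+ n * B / D.
Proof.
move=> D0; elim: n z phi => [|n IH] z phi.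
  rewrite big_ord0 !addr0 => Dz zX.
  have z0 : 0 < normc z by exact: lt_le_trans Dz.
  have -> : J (fun t => riesz_prod 0 t * wave z phi t) = J (wave z phi).
    by apply: eq_mean => t; rewrite /riesz_prod big_ord0 mul1r.
  apply: le_trans (J_wave _ z0 zX) _.
  by rewrite expr0 mul1r ler_wpM2l// lef_pV2.
rewrite big_ord_recr /= => Dz zX.
have L0 := Lam_ge0 n; have l0 := normc_ge0 (z_ n).
have D1 : `|J (fun t => riesz_prod n t * wave z phi t)| <= 2 ^+ n * B / D.
  by apply: IH; lra.
have D2 : `|J (fun t => riesz_prod n t * wave (z_ n + z) (psi_ n + phi) t)| <= 2 ^+ n * B / D.
  apply: IH.
    by have := ler_normcB z (- z_ n); rewrite normc_opp opprK addrC (addrC z); lra.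
  by have := ler_normcD (z_ n) z; lra.
have D3 : `|J (fun t => riesz_prod n t * wave (z_ n - z) (psi_ n - phi) t)| <= 2 ^+ n * B / D.
  apply: IH.
    by have := ler_normcB z (z_ n); rewrite -(normc_opp (z - z_ n)) opprB; lra.
  by have := ler_normcD (z_ n) (- z); rewrite normc_opp; lra.
rewrite mean_rieszS mean_rieszM exprS.
move: D1 D2 D3; rewrite !ler_norml => /andP[? ?] /andP[? ?] /andP[? ?].
by apply/andP; split; lra.
Qed.

Variable c : R.
Hypothesis c0 : 0 < c.

Local Notation err n := (\sum_(i < n) 2 ^+ i * B / (c * ell i)).

Lemma err_term_ge0 i : 0 <= 2 ^+ i * B / (c * ell i).
Proof.
by rewrite divr_ge0 ?mulr_ge0 ?exprn_ge0 ?normc_ge0 ?(ltW c0).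
Qed.

(** Factor [i] adds two waves of frequencies [z_ i + z] and [z_ i - z], whose moduli exceed [Lam i]
    by the margin [c * ell i]; [mean_riesz_far] makes them small. The bound sums over all [i < n] so
    as not to depend on [m]. *)
Lemma mean_riesz_tail n m z phi : (m <= n)%N ->
  (forall i, (m <= i < n)%N -> [/\ 0 < ell i, normc z + c * ell i + Lam i <= ell i &
     normc z + ell i + Lam i <= Xi]) ->
  `|J (fun t => riesz_prod n t * wave z phi t) -
    J (fun t => riesz_prod m t * wave z phi t)| <= err n.
Proof.
move=> mn; elim: n mn => [|n IH] mn hz.
  by move: mn; rewrite leqn0 => /eqP->; rewrite subrr normr0 big_ord0.
move: mn; rewrite leq_eqVlt => /predU1P[<-|]; last rewrite ltnS => mn.
  by rewrite subrr normr0 sumr_ge0// => i _; exact: err_term_ge0.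
have {}IH : `|J (fun t => riesz_prod n t * wave z phi t) -
    J (fun t => riesz_prod m t * wave z phi t)| <= err n.
  by apply: IH => // i /andP[mi ni]; apply: hz; rewrite mi ltnW.
have [l0 l1 l2] := hz n (introT andP (conj mn (ltnSn n))).
have z0 := normc_ge0 z.
have cl : 0 < c * ell n by rewrite mulr_gt0.
have D2 : `|J (fun t => riesz_prod n t * wave (z_ n + z) (psi_ n + phi) t)| <= 2 ^+ n * B / (c * ell n).
  apply: mean_riesz_far => //.
    by have := ler_normcB (z_ n) (- z); rewrite normc_opp opprK; lra.
  by have := ler_normcD (z_ n) z; lra.
have D3 : `|J (fun t => riesz_prod n t * wave (z_ n - z) (psi_ n - phi) t)| <= 2 ^+ n * B / (c * ell n).
  apply: mean_riesz_far => //.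
    by have := ler_normcB (z_ n) z; lra.
  by have := ler_normcD (z_ n) (- z); rewrite normc_opp; lra.
rewrite big_ord_recr /= mean_rieszS mean_rieszM.
move: D2 D3 IH; rewrite !ler_norml => /andP[? ?] /andP[? ?] /andP[? ?].
by apply/andP; split; lra.
Qed.

Lemma mean_riesz1 n :
  (forall i, (i < n)%N -> [/\ 0 < ell i, c * ell i + Lam i <= ell i &
     ell i + Lam i <= Xi]) ->
  `|J (riesz_prod n) - 1| <= err n.
Proof.
move=> hz; have := @mean_riesz_tail n 0 0 0 (leq0n _).
rewrite ComplexField.Normc.normc0.
have -> : J (fun t => riesz_prod 0 t * wave 0 0 t) = 1.
  by rewrite -mean1; apply: eq_mean => t; rewrite /riesz_prod big_ord0 mul1r wave00.
have -> : J (fun t => riesz_prod n t * wave 0 0 t) = J (riesz_prod n).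
  by apply: eq_mean => t; rewrite wave00 mulr1.
by apply => i /hz[? ? ?]; split; rewrite ?add0r.
Qed.

(** The square of wave [m] is 1/2 plus half a wave of frequency [2 z_ m], and this 1/2 is the main
    term. All the other factors contribute only errors. *)
Lemma mean_riesz_diag n m : (m < n)%N ->
  (forall i, (i < n)%N -> [/\ 0 < ell i, c * ell i + Lam i <= ell i &
     ell m + ell i + Lam i <= Xi]) ->
  (forall i, (m < i < n)%N -> ell m + c * ell i + Lam i <= ell i) ->
  1 / 2 - 3 * err n <= J (fun t => riesz_prod n t * wave (z_ m) (psi_ m) t).
Proof.
move=> mn hz hm.
have [l0 l1 l2] := hz m mn.
have lm : err m + 2 ^+ m * B / (c * ell m) <= err n.
  have <- : \sum_(i < m.+1) 2 ^+ i * B / (c * ell i) = err m + 2 ^+ m * B / (c * ell m).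
    by rewrite big_ord_recr.
  rewrite -(subnKC mn) big_split_ord /= lerDl sumr_ge0// => i _.
  exact: err_term_ge0.
have e0 : 0 <= err m by apply: sumr_ge0 => i _; exact: err_term_ge0.
have cl : 0 < c * ell m by rewrite mulr_gt0.
have L0 := Lam_ge0 m.
have T : `|J (fun t => riesz_prod n t * wave (z_ m) (psi_ m) t) -
    J (fun t => riesz_prod m.+1 t * wave (z_ m) (psi_ m) t)| <= err n.
  apply: mean_riesz_tail => // i /andP[mi ni]; have [? ? ?] := hz i ni.
  by split => //; apply: hm; rewrite mi.
have D1 : `|J (fun t => riesz_prod m t * wave (z_ m) (psi_ m) t)| <= 2 ^+ m * B / (c * ell m).
  by apply: mean_riesz_far => //; lra.
have D2 : `|J (fun t => riesz_prod m t * wave (z_ m + z_ m) (psi_ m + psi_ m) t)| <= 2 ^+ m * B / (c * ell m).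
  have E : normc (z_ m + z_ m) = ell m + ell m.
    by rewrite -!mulr2n; exact: (@normcMn R).
  by apply: mean_riesz_far => //; rewrite E; lra.
have D3 : `|J (riesz_prod m) - 1| <= err m.
  apply: mean_riesz1 => i im; have [? ? ?] := hz i (ltn_trans im mn).
  by split => //; lra.
move: T; rewrite mean_rieszS mean_rieszM !subrr.
have -> : J (fun t => riesz_prod m t * wave 0 0 t) = J (riesz_prod m).
  by apply: eq_mean => t; rewrite wave00 mulr1.
move: D1 D2 D3 lm; rewrite !ler_norml.
set u := _ / (c * ell m).
move=> /andP[? ?] /andP[? ?] /andP[? ?] ? /andP[? ?].
lra.
Qed.

(** The frequency [z] sits in a gap: the first [m] factors stay below it by the margin
    [c * normc z], and every later factor dominates it. *)
Lemma mean_riesz_off n m z phi : (m <= n)%N -> 0 < normc z ->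
  (forall i, (m <= i < n)%N -> [/\ 0 < ell i, normc z + c * ell i + Lam i <= ell i &
     normc z + ell i + Lam i <= Xi]) ->
  c * normc z + Lam m <= normc z -> normc z + Lam m <= Xi ->
  `|J (fun t => riesz_prod n t * wave z phi t)| <=
    err n + 2 ^+ m * B / (c * normc z).
Proof.
move=> mn z0 hz l1 l2.
have := @mean_riesz_tail n m z phi mn hz.
have : `|J (fun t => riesz_prod m t * wave z phi t)| <= 2 ^+ m * B / (c * normc z).
  by apply: mean_riesz_far => //; rewrite mulr_gt0.
rewrite !ler_norml => /andP[? ?] /andP[? ?].
by apply/andP; split; lra.
Qed.

End riesz.

(** * Growth of powers and sums along residue classes *)

Section growth.
Variable R : realType.

Lemma exists_nat_ge (x : R) : exists n : nat, x <= n%:R.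
Proof.
exists (Num.bound `|x|); apply: le_trans (ler_norm x) _.
by apply/ltW/archi_boundP.
Qed.

Lemma exp_unbounded (L x : R) : 1 < L -> exists k, x <= L ^+ k.
Proof.
move=> L1.
have bern k : 1 + k%:R * (L - 1) <= L ^+ k.
  elim: k => [|k IH]; first by rewrite mul0r addr0 expr0.
  rewrite exprS -natr1; have k0 : 0 <= k%:R :> R by [].
  have d0 : 0 <= L - 1 by lra.
  have := mulr_ge0 k0 (mulr_ge0 d0 d0).
  have L0 : 0 <= L by lra.
  have := ler_wpM2l L0 IH; lra.
have [k hk] := exists_nat_ge (x / (L - 1)); exists k; apply: le_trans (bern _).
have d0 : 0 < L - 1 by lra.
by move: hk; rewrite ler_pdivrMr//; lra.
Qed.

Lemma sum_ltn_le (m0 n : nat) : \sum_(m < n) (m < m0)%:R <= m0%:R :> R.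
Proof.
have -> : \sum_(m < n) (m < m0)%:R = (minn n m0)%:R :> R.
  elim: n => [|n IH]; first by rewrite big_ord0 min0n.
  by rewrite big_ord_recr/= IH -natrD; congr (_%:R); lia.
by rewrite ler_nat geq_minr.
Qed.

(** A time [m >= m0] is counted in the class [r = (m - m0) %% k]; the times before [m0] are paid for
    by [m0 * M]. *)
Lemma sum_residues (a : nat -> R) (M : R) (k m0 N : nat) : (0 < k)%N ->
  (forall n, 0 <= a n <= M) ->
  \sum_(m < N) a m - m0%:R * M <=
  \sum_(r < k) \sum_(m < N | (m0 + r <= m)%N && (k %| m - (m0 + r))%N) a m.
Proof.
move=> k0 a0M.
rewrite [X in _ <= X](exchange_big_dep predT)//=.
have M0 : 0 <= M by have /andP[h1 h2] := a0M 0; exact: le_trans h2.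
have key (m : nat) : (m < m0)%:R * M + \sum_(i < k | (m0 + i <= m)%N && (k %| m - (m0 + i))%N) a m >= a m.
  have /andP[am aM] := a0M m.
  have [mm0|mm0] := ltnP m m0.
    rewrite mul1r -[leLHS]addr0 lerD// sumr_ge0//.
  have rk : ((m - m0) %% k < k)%N by rewrite ltn_mod.
  rewrite mul0r add0r (bigD1 (Ordinal rk))/=.
    by rewrite lerDl sumr_ge0.
  have H := divn_eq (m - m0) k.
  have E : (m - (m0 + (m - m0) %% k) = (m - m0) %/ k * k)%N.
    by rewrite subnDA {1}H addnK.
  rewrite E dvdn_mull// andbT -leq_subRL//; exact: leq_mod.
rewrite lerBlDr.
apply: le_trans (ler_sum _ (fun (m : 'I_N) _ => key m)) _.
rewrite big_split/= addrC lerD2l -mulr_suml ler_wpM2r//.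
exact: sum_ltn_le.
Qed.

Lemma geometric_sum_le (l0 q c : R) n : 0 <= l0 -> 0 < q -> 0 <= c -> 1 <= c * (q - 1) ->
  \sum_(i < n) l0 * q ^+ i <= c * (l0 * q ^+ n).
Proof.
move=> l00 q0 c0 cq; elim: n => [|n IH].
  by rewrite big_ord0 !mulr_ge0// exprn_ge0// ltW.
rewrite big_ord_recr/= exprS.
have u0 : 0 <= l0 * q ^+ n by rewrite mulr_ge0// exprn_ge0// ltW.
have := ler_wpM2l u0 cq; lra.
Qed.

Lemma err_sum_le (l0 q c B : R) n : 0 < l0 -> 4 <= q -> 0 < c -> 0 <= B ->
  \sum_(i < n) 2 ^+ i * B / (c * (l0 * q ^+ i)) <= 2 * B / (c * l0).
Proof.
move=> l00 q4 c0 B0; have q0 : 0 < q by lra.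
have D0 : 0 <= B / (c * l0) by rewrite divr_ge0// mulr_ge0 ?ltW.
(* As [q >= 4], the [i]-th term is at most [2^-i] times the first; the sharper bound is the one that
   passes through induction. *)
suff H : \sum_(i < n) 2 ^+ i * B / (c * (l0 * q ^+ i)) <=
    B / (c * l0) * (2 - 2 * 2^-1 ^+ n).
  apply: le_trans H _; rewrite -[2 * B / _]mulrA [X in _ <= X]mulrC ler_wpM2l//.
  by rewrite gerBl mulr_ge0// exprn_ge0// invr_ge0.
elim: n => [|n IH]; first by rewrite big_ord0 expr0 mulr1 subrr mulr0.
rewrite big_ord_recr/=.
have -> : 2 ^+ n * B / (c * (l0 * q ^+ n)) = B / (c * l0) * (2 / q) ^+ n.
  by rewrite expr_div_n; field; rewrite !gt_eqF ?exprn_gt0.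
have x2 : (2 / q) ^+ n <= 2^-1 ^+ n.
  rewrite lerXn2r ?nnegrE ?divr_ge0 ?invr_ge0 ?(ltW q0)// ler_pdivrMr//; lra.
have := ler_wpM2l D0 x2; rewrite exprS; lra.
Qed.

End growth.

(** * Riesz products along powers of an expanding root *)

Section lacunary_riesz.
Variable R : realType.
Variables (I : finType) (p : I -> R * R).
Local Notation J := (mean p).
Hypothesis I0 : (0 < #|I|)%N.
Variables (B Xi : R).
Hypothesis B0 : 0 <= B.
Hypothesis J_wave : forall z phi, 0 < normc z -> normc z <= Xi ->
  `|J (wave z phi)| <= B / normc z.
Variables (lam : R[i]) (c : R) (k m1 n : nat) (psi_ : nat -> R).
Local Notation L := (normc lam).
Hypothesis c0 : 0 < c.
Hypothesis L1 : 1 <= L.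
(** The moduli of two distinct powers of [lam] differ by at least [2 * c] times the larger: one [c]
    absorbs the sum of the lower frequencies of the product, the other remains as margin. [k1]
    bounds that sum, and [k4] makes the errors add up to at most [eta]. *)
Hypothesis cL : L^-1 = 1 - 2 * c.
Hypothesis k1 : 1 <= c * (L ^+ k - 1).
Hypothesis k4 : 4 <= L ^+ k.
Hypothesis Xi_ge : 3 * L ^+ (m1 + k * n) <= Xi.

Local Notation z_ := (fun j => lam ^+ (m1 + k * j)).
Local Notation eta := (2 * B / (c * L ^+ m1)).
Local Notation rho := (riesz_prod z_ psi_ n).

Let L0 : 0 < L. Proof. exact: lt_le_trans L1. Qed.

Let cV : c * 2 <= 1.
Proof.
have : 0 <= L^-1 by rewrite invr_ge0 ltW.
by rewrite cL; lra.
Qed.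

Let ellE j : normc (z_ j) = L ^+ m1 * (L ^+ k) ^+ j.
Proof. by rewrite normc_exp exprD exprM. Qed.

Let ell_gt0 j : 0 < normc (z_ j).
Proof. by rewrite normc_exp exprn_gt0. Qed.

Let half_ell j : 2 * (c * normc (z_ j)) <= normc (z_ j).
Proof.
have := ler_wpM2r (ltW (ell_gt0 j)) cV; lra.
Qed.

Let Lam_le j : \sum_(i < j) normc (z_ i) <= c * normc (z_ j).
Proof.
rewrite ellE; under eq_bigr do rewrite ellE.
apply: geometric_sum_le => //; first by rewrite exprn_ge0// ltW.
- by rewrite exprn_gt0.
- exact: ltW.
Qed.

Let err_le j : \sum_(i < j) 2 ^+ i * B / (c * normc (z_ i)) <= eta.
Proof.
under eq_bigr do rewrite ellE.
by apply: err_sum_le => //; rewrite exprn_gt0.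
Qed.

Let err_term j : 2 ^+ j * B / (c * normc (z_ j)) <= eta.
Proof.
apply: le_trans (err_le j.+1); rewrite big_ord_recr/= lerDr sumr_ge0// => i _.
by rewrite divr_ge0 ?mulr_ge0 ?exprn_ge0 ?normc_ge0 ?(ltW c0).
Qed.

Let le_top m : (m <= m1 + k * n)%N -> L ^+ m <= L ^+ (m1 + k * n).
Proof. by move=> ?; rewrite ler_weXn2l. Qed.

Let lt_exp m m' : (m < m')%N -> L ^+ m <= (1 - 2 * c) * L ^+ m'.
Proof.
move=> mm'; rewrite -cL ler_pdivlMl// -exprS.
by rewrite ler_weXn2l.
Qed.

Let k0 : (0 < k)%N.
Proof. by case: k k4 => //; rewrite expr0 => ?; lra. Qed.

Lemma lacunary_mean1 : `|J rho - 1| <= eta.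
Proof.
apply: le_trans (err_le n).
apply: (@mean_riesz1 R I p I0 B Xi z_ psi_ B0 J_wave c c0) => i ni; split => //.
- by have := Lam_le i; have := half_ell i; lra.
- have := Lam_le i; have := half_ell i.
  have := @le_top (m1 + k * i); rewrite leq_add2l leq_mul2l (ltnW ni) orbT -!normc_exp => /(_ isT).
  move: Xi_ge; rewrite -!normc_exp.
  by have := ell_gt0 i; lra.
Qed.

Lemma lacunary_mean_diag j : (j < n)%N ->
  1 / 2 - 3 * eta <= J (fun t => rho t * wave (z_ j) (psi_ j) t).
Proof.
move=> jn.
have diag := @mean_riesz_diag R I p I0 B Xi z_ psi_ B0 J_wave c c0 n j jn.
apply: le_trans (diag _ _).
- by have := err_le n; lra.
- move=> i ni; split => //.
    by have := Lam_le i; have := half_ell i; lra.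
  have := Lam_le i; have := half_ell i.
  have := @le_top (m1 + k * i); rewrite leq_add2l leq_mul2l (ltnW ni) orbT -!normc_exp => /(_ isT).
  have := @le_top (m1 + k * j); rewrite leq_add2l leq_mul2l (ltnW jn) orbT -!normc_exp => /(_ isT).
  move: Xi_ge; rewrite -!normc_exp.
  by have := ell_gt0 i; lra.
- move=> i /andP[ji _]; have := Lam_le i.
  have := @lt_exp (m1 + k * j) (m1 + k * i); rewrite ltn_add2l ltn_mul2l k0 ji => /(_ isT).
  by rewrite -!normc_exp; lra.
Qed.

Lemma lacunary_mean_off m phi : (m1 <= m < m1 + k * n)%N ->
  ~~ (k %| m - m1)%N ->
  `|J (fun t => rho t * wave (lam ^+ m) phi t)| <= 3 * eta.
Proof.
move=> /andP[m1m mn] km.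
have mE := divn_eq (m - m1) k.
have mr : (0 < (m - m1) %% k)%N by rewrite lt0n.
have mk : ((m - m1) %% k < k)%N by rewrite ltn_mod.
(* The exponent [m] lies strictly between [m1 + k * j] and [m1 + k * j.+1], so the product is cut
   after factor [j]. *)
set j := ((m - m1) %/ k)%N in mE; set r := ((m - m1) %% k)%N in mE mr mk.
have jn : (j < n)%N by rewrite -(ltn_pmul2l k0); nia.
have jm : (m1 + k * j < m)%N by nia.
have mj i : (j < i)%N -> (m < m1 + k * i)%N by nia.
have h1 := lt_exp jm.
have Lj : \sum_(i < j.+1) normc (z_ i) <= (1 + c) * normc (z_ j).
  by rewrite big_ord_recr/=; have := Lam_le j; lra.
have lj := ell_gt0 j.
have e0 : 0 < L ^+ m by rewrite exprn_gt0.
have LT : c * normc (lam ^+ m) + \sum_(i < j.+1) normc (z_ i) <= normc (lam ^+ m).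
  have : (1 + c) * normc (z_ j) <= (1 + c) * ((1 - 2 * c) * L ^+ m).
    by rewrite normc_exp; apply: ler_wpM2l h1; move: c0; lra.
  rewrite [normc (lam ^+ m)]normc_exp; have : 0 <= c * c * L ^+ m by rewrite !mulr_ge0 ?ltW.
  by move: Lj; lra.
have mtop := le_top (ltnW mn).
have off := @mean_riesz_off R I p B Xi z_ psi_ B0 J_wave c c0 n j.+1 (lam ^+ m) phi jn.
apply: le_trans (off _ _ LT _) _.
- by rewrite normc_exp.
- move=> i /andP[ji ni]; split => //.
    have := lt_exp (mj i ji); have := Lam_le i.
    by rewrite -!normc_exp; lra.
  have := Lam_le i; have := half_ell i.
  have := @le_top (m1 + k * i); rewrite leq_add2l leq_mul2l (ltnW ni) orbT -!normc_exp => /(_ isT).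
  by move: Xi_ge mtop; rewrite -!normc_exp; have := ell_gt0 i; lra.
- have cz : 0 <= c * normc (lam ^+ m) by rewrite mulr_ge0 ?normc_ge0 ?ltW.
  by move: Xi_ge mtop LT cz e0; rewrite -!normc_exp; lra.
have -> : 3 * eta = eta + 2 * eta by lra.
apply: lerD; first exact: err_le.
apply: le_trans (ler_wpM2l _ (err_term j)); last by [].
rewrite exprS -!mulrA ler_wpM2l// ler_wpM2l ?exprn_ge0// ler_wpM2l//.
rewrite lef_pV2 ?posrE ?mulr_gt0 ?normc_exp//; last by rewrite -normc_exp.
by rewrite ler_wpM2l ?(ltW c0)// ler_weXn2l// ltnW.
Qed.

End lacunary_riesz.

(** * Density of the parameters with large correlation *)

Section riesz_density.
Variable R : realType.
Variables (lam : R[i]) (a phi : nat -> R) (M delta : R).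
Hypothesis lam1 : 1 < normc lam.
Hypothesis a0M : forall n, 0 <= a n <= M.
Hypothesis delta0 : 0 < delta.
Hypothesis a_freq : forall N0, exists2 N : nat, (N0 <= N)%N &
  delta * N%:R <= \sum_(n < N) a n.

Local Notation L := (normc lam).
Local Notation S N t := (\sum_(n < N) a n * wave (lam ^+ n) (phi n) t).

(** The mean of [S N] against the density [rho] is bounded twice: by [2 * C] from above, as [rho] is
    nonnegative with mean at most 2, and from below by about [a m / 2] for each time [m] of the
    progression [m1 + k * j]. *)
Lemma riesz_sum_le (I : finType) (p : I -> R * R) (B Xi c C : R) (k m1 N : nat) :
  (0 < #|I|)%N -> 0 <= B ->
  (forall z phi, 0 < normc z -> normc z <= Xi ->
    `|mean p (wave z phi)| <= B / normc z) ->
  0 < c -> L^-1 = 1 - 2 * c -> 1 <= c * (L ^+ k - 1) -> 4 <= L ^+ k ->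
  3 * L ^+ (m1 + k * N) <= Xi ->
  2 * B / (c * L ^+ m1) <= 1 -> 0 <= C ->
  (forall i, S N (p i) <= C) ->
  (\sum_(m < N | (m1 <= m)%N && (k %| m - m1)%N) a m) / 2 <=
     2 * C + 3 * (2 * B / (c * L ^+ m1)) * M * N%:R + 2 * m1%:R * M.
Proof.
move=> I0 B0 J_wave c0 cL k1 k4 Xi_ge eta1 C0 SC.
set eta := 2 * B / (c * L ^+ m1) in eta1 *.
have L0 : 0 < L by apply: lt_trans lam1.
have eta0 : 0 <= eta by rewrite divr_ge0 ?mulr_ge0 ?exprn_ge0 ?(ltW c0) ?(ltW L0).
have M0 : 0 <= M by have /andP[h1 h2] := a0M 0; exact: le_trans h2.
pose z_ j := lam ^+ (m1 + k * j); pose psi_ j := phi (m1 + k * j)%N.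
pose rho := riesz_prod z_ psi_ N.
have J1 : `|mean p rho - 1| <= eta.
  exact: (@lacunary_mean1 R I p I0 B Xi B0 J_wave lam c k m1 N psi_ c0 (ltW lam1) cL k1 k4 Xi_ge).
have k0 : (0 < k)%N by case: (k) k4 => //; rewrite expr0 => ?; lra.
have term (m : 'I_N) : (if (m1 <= m)%N && (k %| m - m1)%N then a m / 2 else 0) -
     3 * eta * M - (m < m1)%:R * (2 * M) <=
   mean p (fun t => rho t * (a m * wave (lam ^+ m) (phi m) t)).
  have /andP[am aM] := a0M m.
  have -> : mean p (fun t => rho t * (a m * wave (lam ^+ m) (phi m) t)) =
      a m * mean p (fun t => rho t * wave (lam ^+ m) (phi m) t).
    by rewrite -meanZ; apply: eq_mean => t; rewrite mulrCA.
  set q := mean _ _.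
  (* Before time [m1] no orthogonality is available; the trivial bound by the mean of [rho] costs at
     most [2 * M] per time. *)
  have [mm1|m1m] := ltnP m m1.
    rewrite /= mul1r add0r.
    have q2 : - 2 <= q.
      apply: (@le_trans _ _ (- mean p rho)).
        by move: J1; rewrite ler_norml => /andP[]; lra.
      rewrite -[- mean _ _]mulN1r -meanZ; apply: le_mean => t.
      have := riesz_prod_ge0 z_ psi_ N t; rewrite -/rho => r0.
      have := wave_le1 (lam ^+ m) (phi m) t; rewrite ler_norml => /andP[w1 _].
      by have := ler_wpM2l r0 w1; lra.
    have := ler_wpM2l am q2; have := mulr_ge0 eta0 M0; lra.
  rewrite /= mul0r subr0.
  have [kd|kd] := boolP (k %| m - m1)%N.
    have [j jE] := dvdnP kd.
    have mE : (m = m1 + k * j :> nat)%N by rewrite mulnC -jE subnKC.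
    have jN : (j < N)%N.
      apply: leq_ltn_trans (ltn_ord m).
      by rewrite [X in (_ <= X)%N]mE; apply: leq_trans (leq_addl _ _); exact: leq_pmull.
    have : 1 / 2 - 3 * eta <= q.
      rewrite /q mE.
      exact: (@lacunary_mean_diag R I p I0 B Xi B0 J_wave lam c k m1 N psi_ c0 (ltW lam1) cL k1 k4 Xi_ge).
    move=> h; have := ler_wpM2l am h; have := ler_wpM2l eta0 aM; lra.
  have : `|q| <= 3 * eta.
    have off := @lacunary_mean_off R I p I0 B Xi B0 J_wave lam c k m1 N psi_ c0 (ltW lam1) cL k1 k4 Xi_ge m (phi m).
    apply: off => //.
    rewrite m1m (leq_trans (ltn_ord m))//.
    by apply: leq_trans (leq_addl _ _); exact: leq_pmull.
  rewrite ler_norml => /andP[h _].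
  by have := ler_wpM2l am h; have := ler_wpM2l eta0 aM; lra.
have : \sum_(m < N) mean p (fun t => rho t * (a m * wave (lam ^+ m) (phi m) t)) <= 2 * C.
  rewrite -(mean_sum p N (fun m t => rho t * (a m * wave (lam ^+ m) (phi m) t))).
  apply: (@le_trans _ _ (C * mean p rho)); last first.
    rewrite mulrC ler_wpM2r//.
    by move: J1; rewrite ler_norml => /andP[]; lra.
  rewrite -meanZ /mean ler_wpM2l ?invr_ge0 ?ler0n//; apply: ler_sum => i _.
  rewrite -mulr_sumr mulrC ler_wpM2r//; exact: riesz_prod_ge0.
move/(le_trans (ler_sum _ (fun m _ => term m))).
rewrite !sumrB -big_mkcond sumr_const card_ord -mulr_suml -mulr_suml.
have := ler_wpM2r (_ : 0 <= 2 * M) (sum_ltn_le R m1 N); rewrite mulr_ge0// => /(_ isT).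
rewrite -mulr_natr; lra.
Qed.

Lemma gridpt_bounds (t0 : R * R) (h : R) G (i : 'I_G * 'I_G) : 0 <= h ->
  t0.1 <= (gridpt t0 h i).1 <= t0.1 + h /\ t0.2 <= (gridpt t0 h i).2 <= t0.2 + h.
Proof.
move=> h0.
have key (j : 'I_G) : 0 <= j%:R * (h / G%:R) <= h.
  have G0 : 0 < G%:R :> R by rewrite ltr0n; case: (G) j => // -[].
  rewrite mulr_ge0 ?divr_ge0//= mulrCA ler_piMr// ler_pdivrMr// mul1r.
  by rewrite ler_nat ltnW.
have /andP[? ?] := key i.1; have /andP[? ?] := key i.2.
by split; apply/andP; split; rewrite /gridpt /=; lra.
Qed.

(** The constant [c1] is fixed before the square and [N0], as the use of Baire's theorem requires.
    All residue classes modulo [k] are treated at once: if every grid point failed, the bounds for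
    the classes would add up to less than [delta * N]. *)
Lemma riesz_dense : exists2 c1, 0 < c1 &
  forall (t0 : R * R) (h : R) (N0 : nat), 0 < h -> exists (N : nat) (t : R * R),
   [/\ (N0 <= N)%N, t0.1 <= t.1 <= t0.1 + h, t0.2 <= t.2 <= t0.2 + h &
       c1 * N%:R < S N t].
Proof.
have L0 : 0 < L by apply: lt_trans lam1.
have M0 : 0 <= M by have /andP[h1 h2] := a0M 0; exact: le_trans h2.
pose c : R := (1 - L^-1) / 2.
have cL : L^-1 = 1 - 2 * c by rewrite /c; lra.
have c0 : 0 < c by rewrite divr_gt0// subr_gt0 invf_lt1.
clearbody c.
have [k kP] := exp_unbounded (5 + 1 / c) lam1.
have ic0 : 0 <= 1 / c by rewrite divr_ge0// ltW.
have k4 : 4 <= L ^+ k by lra.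
have k1 : 1 <= c * (L ^+ k - 1).
  have cc : c * (1 / c) = 1 by rewrite mulrC divfK// gt_eqF.
  have H : 1 / c <= L ^+ k - 1 by lra.
  by have := ler_wpM2l (ltW c0) H; rewrite cc.
have k0 : (0 < k)%N by case: (k) k4 => //; rewrite expr0 => ?; lra.
have kR : 0 < k%:R :> R by rewrite ltr0n.
(* The [k] classes contribute [4 * k * c1 * N] in total, which the factor 16 makes
   [delta * N / 4]. *)
pose c1 := delta / (16 * k%:R).
have c10 : 0 < c1 by rewrite divr_gt0// mulr_gt0.
exists c1 => // t0 h N0 h0.
pose B := 2 / (cos 1 * pi * h).
have B0 : 0 <= B.
  by rewrite divr_ge0// !mulr_ge0 ?(ltW h0)// ltW ?cos1_gt0 ?pi_gt0.
(* [1 / x] will bound the relative error; the constant 24 makes [6 * k * M / x] at most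
   [delta / 4]. *)
pose x := 1 + 24 * k%:R * M / delta.
have x0 : 1 <= x by rewrite /x lerDl divr_ge0 ?mulr_ge0// ltW.
have xd : x * delta = delta + 24 * k%:R * M.
  by rewrite /x mulrDl mul1r divfK// gt_eqF.
clearbody x.
have [m0 m0P] := exp_unbounded (2 * B / c * x) lam1.
(* From [N1] on, the contributions free of [N] stay below [delta * N / 2]. *)
have [N1 N1P] := exists_nat_ge ((m0%:R * M + 4 * k%:R * (m0%:R + k%:R) * M) * 2 / delta + 1).
have [N NN aN] := a_freq (maxn N0 N1).
pose Xi : R := 3 * L ^+ (m0 + k + k * N).
(* The grid is chosen after [N], fine enough to resolve all frequencies up to [Xi]. *)
have [G GP] := exists_nat_ge (1 + pi * Xi * h).
have G0 : (0 < G)%N.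
  rewrite -(ltr_nat R); apply: lt_le_trans GP.
  by rewrite ltr_pwDl// !mulr_ge0// ?pi_ge0 ?exprn_ge0 ?ltW.
have GB z phi' : 0 < normc z -> normc z <= Xi ->
    `|mean (@gridpt R t0 h G) (wave z phi')| <= B / normc z.
  move=> z0 zX; apply: mean_wave_grid => //.
    by apply: contraL z0 => /eqP->; rewrite ComplexField.Normc.normc0 ltxx.
  rewrite -!mulrA ler_pM2l// mulrA.
  have : pi * normc z * h <= pi * Xi * h.
    by rewrite ler_wpM2r ?(ltW h0)// ler_wpM2l// pi_ge0.
  lra.
apply: contrapT => nex.
have SC i : S N (@gridpt R t0 h G i) <= c1 * N%:R.
  rewrite leNgt; apply/negP => SN; apply: nex.
  exists N, (gridpt t0 h i).
  have [b1 b2] := gridpt_bounds t0 i (ltW h0).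
  by split => //; apply: leq_trans NN; exact: leq_maxl.
have I0 : (0 < #|{: 'I_G * 'I_G}|)%N by rewrite card_prod card_ord muln_gt0 G0.
have cl (r : 'I_k) : \sum_(m < N | (m0 + r <= m)%N && (k %| m - (m0 + r))%N) a m <=
    4 * c1 * N%:R + 6 * (M / x) * N%:R + 4 * (m0%:R + k%:R) * M.
  have eta_le : 2 * B / (c * L ^+ (m0 + r)) <= 1 / x.
    have Lm0 : 0 < L ^+ (m0 + r) by rewrite exprn_gt0.
    rewrite ler_pdivrMr ?mulr_gt0// mulrAC mul1r ler_pdivlMr; last by lra.
    have : L ^+ m0 <= L ^+ (m0 + r) by rewrite ler_weXn2l ?(ltW lam1)// leq_addr.
    move=> /(le_trans m0P) /(ler_wpM2l (ltW c0)).
    have -> : c * (2 * B / c * x) = 2 * B * x by field; rewrite gt_eqF.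
    by [].
  have x1 : 1 / x <= 1 by rewrite ler_pdivrMr ?mul1r//; lra.
  have Xi_ge : 3 * L ^+ (m0 + r + k * N) <= Xi.
    by rewrite ler_pM2l// ler_weXn2l ?(ltW lam1)// leq_add2r leq_add2l ltnW.
  have C0 : 0 <= c1 * N%:R by rewrite mulr_ge0// ltW.
  have := riesz_sum_le I0 B0 GB c0 cL k1 k4 Xi_ge (le_trans eta_le x1) C0 SC.
  have rk : r%:R <= k%:R :> R by rewrite ler_nat ltnW.
  have := ler_wpM2r M0 rk.
  have MN : 0 <= M * N%:R by rewrite mulr_ge0.
  have := ler_wpM2r MN eta_le; rewrite natrD; lra.
have := sum_residues m0 N k0 a0M.
move=> /le_trans/(_ (ler_sum _ (fun r _ => cl r))).
rewrite sumr_const card_ord -[X in _ <= X -> _]mulr_natl.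
have kMx : 6 * k%:R * (M / x) <= delta / 4.
  have x0' : 0 < x by lra.
  by rewrite mulrA ler_pdivrMr//; move: (delta0); lra.
have kc1 : 16 * (k%:R * c1) = delta.
  by rewrite /c1; field; rewrite gt_eqF.
have NR : N1%:R <= N%:R :> R by rewrite ler_nat; apply: leq_trans NN; exact: leq_maxr.
have N0' : 0 <= N%:R :> R by [].
have h1 := ler_wpM2r N0' kMx.
have h2 : (m0%:R * M + 4 * k%:R * (m0%:R + k%:R) * M) * 2 < N%:R * delta.
  by rewrite -ltr_pdivrMr//; lra.
have h3 : 16 * (k%:R * c1) * N%:R = delta * N%:R by rewrite kc1.
lra.
Qed.

End riesz_density.

(** * Baire's theorem in the plane of parameters *)

HB.instance Definition _ (R : realType) m n := Complete.on 'M[R]_(m.+1, n.+1).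

Section expanding_point.
Variable R : realType.
Local Open Scope classical_set_scope.
Local Open Scope ring_scope.

Lemma expanding_point (lam : R[i]) (a phi : nat -> R) (M delta : R) :
  1 < normc lam -> (forall n, 0 <= a n <= M) -> 0 < delta ->
  (forall N0, exists2 N : nat, (N0 <= N)%N & delta * N%:R <= \sum_(n < N) a n) ->
  exists t : R * R, exists2 c1, 0 < c1 & forall N0, exists2 N : nat, (N0 <= N)%N &
    c1 * N%:R <= \sum_(n < N) a n * wave (lam ^+ n) (phi n) t.
Proof.
move=> lam1 a0M delta0 a_freq.
have [c1 c10 dns] := @riesz_dense R lam a phi M delta lam1 a0M delta0 a_freq.
pose pt (v : 'rV[R]_2) := (v 0 0, v 0 1) : R * R.
pose S N t := \sum_(n < N) a n * wave (lam ^+ n) (phi n) t.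
have cpt (i : 'I_2) (v : 'rV[R]_2) : (w : 'rV[R]_2) 0 i @[w --> v] --> v 0 i.
  exact: coord_continuous.
have cphase (x y u : R) (v : 'rV[R]_2) :
    2 * pi * (x * (pt w).1 - y * (pt w).2) + u @[w --> v] -->
    2 * pi * (x * (pt v).1 - y * (pt v).2) + u.
  apply: (@cvgD _ _ _ (nbhs v)); last exact: cvg_cst.
  apply: (@cvgMl_tmp _ _ (nbhs v)).
  by apply: (@cvgB _ _ _ (nbhs v)); apply: (@cvgMl_tmp _ _ (nbhs v)); exact: cpt.
have cS N : continuous (fun v => S N (pt v)).
  apply: continuous_big => [|i _ v]; first exact: add_continuous.
  apply: (@cvgMl_tmp _ _ (nbhs v)).
  apply: (@cvg_comp _ _ _ _ (@cos R)); first exact: cphase.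
  exact: continuous_cos.
(* A point of all the [U j] has large correlation averages at arbitrarily late times; each [U j] is
   open by continuity and dense by [riesz_dense]. *)
pose U j := \bigcup_(N in [set N | (j <= N)%N])
  ((fun v => S N (pt v)) @^-1` [set x | c1 * N%:R < x]).
have [|v [_ Uv]] := @Baire R 'rV[R]_2 U _ setT (ex_intro _ 0 I) openT.
  move=> j; split.
    apply: bigcup_open => N _; apply: open_comp; last exact: open_gt.
    by move=> v _; exact: cS.
  move=> O [v Ov] oO.
  have [e /= e0 veO] : nbhs_ball v O by apply/nbhs_ballP; exact: open_nbhs_nbhs.
  (* The square is closed while the ball is open, hence half the radius. *)
  have e20 : 0 < e / 2 by rewrite divr_gt0.
  have [N [t [jN /andP[t1 t1'] /andP[t2 t2'] cS']]] := dns (pt v) (e / 2) j e20.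
  exists (\row_(i < 2) (if i == 0 then t.1 else t.2)).
  have ptE : pt (\row_(i < 2) (if i == 0 then t.1 else t.2)) = t.
    by rewrite /pt !mxE /=; case: (t).
  split; last by exists N => //=; rewrite ptE.
  apply: veO; split => // i k; rewrite mxE ord1.
  rewrite /ball /=; case: ifPn => [/eqP->|k0].
    by rewrite ltr_norml /=; move: t1 t1'; rewrite /pt /=; lra.
  have -> : k = 1 by apply/val_inj; case: k k0 => -[|[|]].
  by rewrite ltr_norml /=; move: t2 t2'; rewrite /pt /=; lra.
exists (pt v), c1 => // N0; have [N /= N0N cSN] := Uv N0 I.
by exists N => //; exact: ltW.
Qed.

End expanding_point.

(** * Leading coefficients of absolute value at least 2 *)

Section trig_shift.
Variable R : realType.
Implicit Types (x y : R) (j : int).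

Lemma abs_cos_shift x j : `|cos (x + j%:~R * pi)| = `|cos x|.
Proof.
have nat_case n z : `|cos (z + n%:R * pi)| = `|cos z|.
  elim: n z => [|n IH] z; first by rewrite mul0r addr0.
  have -> : z + n.+1%:R * pi = (z + n%:R * pi) + pi by rewrite -natr1; lra.
  by rewrite cosDpi normrN.
case: j => n; first exact: nat_case.
rewrite NegzE mulrNz mulNr -[in RHS](subrK (n.+1%:R * pi) x).
exact/esym/nat_case.
Qed.

Lemma abs_cos_odd_shift x j :
  `|cos (x + (2 * j + 1)%:~R * (pi / 2))| = `|sin x|.
Proof.
have -> : x + (2 * j + 1)%:~R * (pi / 2) = (x + pi / 2) + j%:~R * pi.
  by rewrite intrD intrM; lra.
by rewrite abs_cos_shift cosDpihalf normrN.
Qed.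

Lemma abs_cos_sin_ge1 x : 1 <= `|cos x| + `|sin x|.
Proof.
rewrite -(cos2Dsin2 x) lerD// -real_normK ?num_real// expr2 ler_piMr//.
- exact: cos_max.
- exact: sin_max.
Qed.

Lemma half_shift_abs x y : exists2 e : R, e = 0 \/ e = 1 &
  cos (2 * pi * ((y + e) / 2) + x) = `|cos (pi * y + x)|.
Proof.
have [c0|c0] := leP 0 (cos (pi * y + x)).
  exists 0; first by left.
  by rewrite ger0_norm//; congr cos; lra.
exists 1; first by right.
rewrite ltr0_norm// -cosDpi; congr cos; lra.
Qed.

Lemma cos_pi3_gt0 : 0 < cos (pi / 3) :> R.
Proof. by apply: cos_gt0_pihalf; have := pi_gt0 R; lra. Qed.

(** The admissible [z] are spaced by [1 / |q|], so one of them is within half a spacing of the point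
    where the angle vanishes; this leaves an angle of at most [pi / |q|], hence at most [pi / 3]. *)
Lemma round_cos (q : int) (y x : R) : 3 <= `|q| -> exists2 z,
  q%:~R * z + y \is a Num.int & cos (pi / 3) <= cos (2 * pi * z + x).
Proof.
move=> q3; have pi0 := pi_gt0 R.
have qR : 3 <= `|q%:~R| :> R by rewrite -intr_norm (ler_int _ 3).
have q0 : q%:~R != 0 :> R by rewrite -normr_gt0; lra.
pose u : R := y - q%:~R * x / (2 * pi); pose j := Num.floor (u + 1 / 2).
have /andP[j1 j2] : j%:~R <= u + 1 / 2 < j%:~R + 1.
  by rewrite floor_le /=; have := floorD1_gt (u + 1 / 2); rewrite intrD.
exists ((j%:~R - y) / q%:~R).
  by rewrite mulrC divfK// subrK intr_int.
have E : 2 * pi * ((j%:~R - y) / q%:~R) + x = 2 * pi * ((j%:~R - u) / q%:~R).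
  rewrite /u; move: pi0; generalize (pi : R) => p p0; field.
  by rewrite q0 gt_eqF.
rewrite E -[cos (2 * pi * _)]cos_norm.
set t := `|2 * pi * _|.
have t3 : t <= pi / 3.
  rewrite /t !normrM normfV (gtr0_norm pi0) (ger0_norm (ler0n _ 2)).
  rewrite mulrA ler_pdivrMr; last by lra.
  have ju : `|j%:~R - u| <= 1 / 2 by rewrite ler_norml; lra.
  have := ler_wpM2l (ltW pi0) ju; have := ler_wpM2l (ltW pi0) qR; lra.
have t0 : 0 <= t by exact: normr_ge0.
rewrite leNgt ltr_cos ?in_itv /= ?t0 -?leNgt//=; lra.
Qed.

End trig_shift.

(** The recursion runs on finite histories: [Q n h] reads [h] only below [n], so the list of earlier
    choices, padded by [t0], can replace [h]. *)
Lemma dependent_recursion (T : Type) (Q : nat -> (nat -> T) -> T -> Prop) (t0 : T) :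
  (forall n h h' v, (forall m, (m < n)%N -> h m = h' m) -> Q n h v -> Q n h' v) ->
  (forall n h, exists v, Q n h v) ->
  exists z : nat -> T, forall n, Q n z (z n).
Proof.
move=> Qloc Qex.
have [f fP] := choice (fun l : seq T => Qex (size l) (nth t0 l)).
pose hist n := iter n (fun l => rcons l (f l)) [::].
exists (fun n => f (hist n)) => n.
have histE m : hist m = mkseq (fun n => f (hist n)) m.
  by elim: m => // m IH; rewrite mkseqS -IH.
have sz m : size (hist m) = m by rewrite histE size_mkseq.
have := fP (hist n); rewrite sz; apply: Qloc => m mn.
by rewrite {1}histE nth_mkseq.
Qed.

Section frequently.

Definition frequently (P : nat -> Prop) := forall N0, exists2 N, (N0 <= N)%N & P N.

Lemma frequently_or (P Q : nat -> Prop) :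
  frequently (fun N => P N \/ Q N) -> frequently P \/ frequently Q.
Proof.
move=> fPQ; have [|nP] := pselect (frequently P); first by left.
right => N0; have [N1 hN1] : exists N1, forall N, (N1 <= N)%N -> ~ P N.
  apply: contrapT => H; apply: nP => N1; apply: contrapT => H1; apply: H.
  by exists N1 => N N1N PN; apply: H1; exists N.
have [N + [PN|QN]] := fPQ (maxn N0 N1); rewrite geq_max => /andP[? N1N].
  by case: (hN1 N).
by exists N.
Qed.

Lemma frequently_large (P : nat -> Prop) n0 :
  frequently P -> frequently (fun N => (n0 <= N)%N /\ P N).
Proof.
move=> fP N0; have [N + PN] := fP (maxn N0 n0).
by rewrite geq_max => /andP[? ?]; exists N.
Qed.

Lemma frequently_impl (P Q : nat -> Prop) :
  (forall n, P n -> Q n) -> frequently P -> frequently Q.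
Proof. by move=> PQ fP N0; have [N ? ?] := fP N0; exists N; last exact: PQ. Qed.

End frequently.

(** * Solutions of the recurrence with zero past *)

Section causal_solutions.
Variable R : realType.
Implicit Types (x y : nat -> R).

Definition lag x n d : R := if (d <= n)%N then x (n - d)%N else 0.

Lemma lag0 x n : lag x n 0 = x n. Proof. by rewrite /lag subn0. Qed.

Lemma eq_lag x x' n d : (0 < d)%N -> (forall m, (m < n)%N -> x m = x' m) ->
  lag x n d = lag x' n d.
Proof.
move=> d0 xx'; rewrite /lag; case: leqP => // dn; apply: xx'.
by rewrite ltn_subrL d0 (leq_trans d0).
Qed.

Definition extend0 x (n : int) : R := if n is Posz m then x m else 0.

Lemma extend0_lag x (m d : nat) : extend0 x (m%:Z - d%:Z) = lag x m d.
Proof.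
rewrite /lag; case: leqP => dm; first by rewrite subzn.
case E : (m%:Z - d%:Z) => [k|k] //.
by exfalso; move: dm E; lia.
Qed.

(** With [size F = s.+1], the latest time in the sum at [n] is [n + s]. Read backwards from there,
    the sum is that of the hypothesis, and it vanishes when [n + s] is negative. *)
Lemma causal_solution (F : {poly int}) x :
  (forall n, \sum_(d < size F) (F`_((size F).-1 - d))%:~R * lag x n d \is a Num.int) ->
  forall n : int, \sum_(i < size F) (F`_i)%:~R * extend0 x (n + i%:Z) \is a Num.int.
Proof.
move: (size F) => [|s] hx n; first by rewrite big_ord0 rpred0.
rewrite (reindex_inj rev_ord_inj) /=.
have E (i : 'I_s.+1) : n + (s.+1 - i.+1)%N%:Z = (n + s%:Z) - i%:Z.
  have is' : (i <= s)%N := ltn_ord i.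
  by rewrite subSS -subzn//; lia.
under eq_bigr do rewrite E subSS.
case: (n + s%:Z) => m.
  by under eq_bigr do rewrite extend0_lag; exact: hx.
rewrite big1 ?rpred0// => i _.
have -> : extend0 x (Negz m - i%:Z) = 0.
  by case E' : (Negz m - i%:Z) => [k|k] //; exfalso; move: E'; lia.
by rewrite mulr0.
Qed.

(** Once the past is fixed, the recurrence leaves [x n] free up to multiples of [1 / c 0], and
    [round_cos] picks a good value. *)
Lemma causal_lead_ge3 (c : nat -> int) s (phi : nat -> R) : 3 <= `|c 0| ->
  exists x, (forall n, \sum_(d < s.+1) (c d)%:~R * lag x n d \is a Num.int) /\
    forall n, cos (pi / 3) <= cos (2 * pi * x n + phi n).
Proof.
move=> c3.
pose Q n (h : nat -> R) v :=
  (c 0)%:~R * v + \sum_(d < s) (c d.+1)%:~R * lag h n d.+1 \is a Num.int /\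
  cos (pi / 3) <= cos (2 * pi * v + phi n).
have [|n h|x xP] := @dependent_recursion R Q 0.
- move=> n h h' v hh' [Q1 Q2]; split=> //.
  move: Q1; congr (is_true (_ + _ \is a _)); apply: eq_bigr => d _.
  by congr (_ * _); exact: eq_lag.
- have [z z1 z2] := round_cos (\sum_(d < s) (c d.+1)%:~R * lag h n d.+1) (phi n) c3.
  by exists z.
exists x; split => n; have [Q1 Q2] := xP n => //.
by rewrite big_ord_recl lag0.
Qed.

Lemma sum_shift_bounds (u : nat -> R) (M : R) l N : (forall n, 0 <= u n <= M) ->
  \sum_(m < N) u m - l%:R * M <= \sum_(m < N) u (m + l)%N <=
  \sum_(m < N) u m + l%:R * M.
Proof.
move=> u0M.
have bnd (v : nat -> nat) : 0 <= \sum_(m < l) u (v m) <= l%:R * M.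
  apply/andP; split; first by apply: sumr_ge0 => m _; have /andP[] := u0M (v m).
  have -> : l%:R * M = \sum_(m < l) M by rewrite sumr_const card_ord mulr_natl.
  by apply: ler_sum => m _; have /andP[] := u0M (v m).
have E1 : \sum_(m < l + N) u m = \sum_(m < l) u m + \sum_(m < N) u (m + l)%N.
  by rewrite big_split_ord; congr (_ + _); apply: eq_bigr => m _; congr u; rewrite /= addnC.
have E2 : \sum_(m < l + N) u m = \sum_(m < N) u m + \sum_(m < l) u (N + m)%N.
  by rewrite addnC big_split_ord.
have := bnd id; have := bnd (fun m => N + m)%N.
by move=> /andP[? ?] /andP[? ?]; apply/andP; split; lra.
Qed.

(* Here [c d = 2 b d] is even for [d < l] and [c l] is odd.  Writing [y = 2 x] modulo 1,
   [y (n + l)] is determined by the values [x m] with [m <= n], and replacing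
   [x n] by [x n + 1/2] moves it by an odd multiple of 1/2. *)
Lemma causal_lead2 (c : nat -> int) s l (b : nat -> int) (k : int) (a phi : nat -> R)
    (p : bool) :
  (0 < l <= s)%N -> b 0 * b 0 = 1 -> (forall d, (d < l)%N -> c d = 2 * b d) ->
  c l = 2 * k + 1 -> (forall n, 0 <= a n) ->
  let H2 n := odd (n %/ l) (+) p in
  exists x y, [/\ forall n, \sum_(d < s.+1) (c d)%:~R * lag x n d \is a Num.int,
    forall n, H2 n -> cos (2 * pi * x n + phi n) = `|cos (pi * y n + phi n)| &
    forall n, ~~ H2 n -> a (n + l)%N / 2 <= a n * cos (2 * pi * x n + phi n) +
      a (n + l)%N * `|cos (pi * y (n + l)%N + phi (n + l)%N)|].
Proof.
move=> /andP[l0 ls] bb cb cl a0 H2.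
(* The recursion stores the pair of [x n] and [y (n + l)] at time [n], so [yw] recovers [y n] from
   the pair stored [l] steps earlier; the first [l] values of [y] are 0. *)
pose yw (w : nat -> R) n := if (n < l)%N then 0 else w (n - l)%N.
pose rest (h : nat -> R * R) n := \sum_(d < s.+1 | (0 < d < l)%N)
    (b d)%:~R * lag (fun m => (h m).2) n d +
  \sum_(d < s.+1 | (l < d)%N) (c d)%:~R * lag (fun m => (h m).1) n (d - l).
(* The second condition solves the recurrence at time [n + l] exactly, with [b d * y] in place of
   [c d * x] for [d < l]; the sign [b 0] is its own inverse. *)
pose Q n (h : nat -> R * R) (v : R * R) :=
  let y := yw (fun m => (h m).2) n in
  [/\ 2 * v.1 - y \is a Num.int,
      v.2 = - (b 0)%:~R * (rest h n + (c l)%:~R * v.1),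
      H2 n -> cos (2 * pi * v.1 + phi n) = `|cos (pi * y + phi n)| &
      ~~ H2 n -> a (n + l)%N / 2 <= a n * cos (2 * pi * v.1 + phi n) +
       a (n + l)%N * `|cos (pi * v.2 + phi (n + l)%N)|].
have [|n h|z zP] := @dependent_recursion (R * R)%type Q (0, 0).
- move=> n h h' v hh' [Q1 Q2 Q3 Q4].
  have yE : yw (fun m => (h' m).2) n = yw (fun m => (h m).2) n.
    rewrite /yw; case: ltnP => // ln; rewrite hh'//.
    by rewrite ltn_subrL l0 (leq_trans l0).
  have rE : rest h' n = rest h n.
    rewrite /rest; congr (_ + _); apply: eq_bigr => d hd; congr (_ * _).
      by apply: eq_lag => [|m mn]; [case/andP: hd|rewrite hh'].
    by apply: eq_lag => [|m mn]; [rewrite subn_gt0|rewrite hh'].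
  by split => //; rewrite ?yE ?rE.
- pose y := yw (fun m => (h m).2) n.
  pose w e := - (b 0)%:~R * (rest h n + (c l)%:~R * ((y + e) / 2)).
  have [H2n|H2n] := boolP (H2 n).
    have [e e01 eP] := half_shift_abs (phi n) y.
    exists ((y + e) / 2, w e); split => //=; last by rewrite H2n.
    by rewrite -/y; case: e01 => ->; rewrite mulrC divfK// addrAC subrr add0r ?rpred0 ?rpred1.
  have goal e : e = 0 \/ e = 1 -> a (n + l)%N / 2 <= a n * cos (2 * pi * ((y + e) / 2) + phi n) +
       a (n + l)%N * `|cos (pi * w e + phi (n + l)%N)| -> exists v, Q n h v.
    move=> e01 he; exists ((y + e) / 2, w e); split => //=; last by move/negP : H2n.
    by rewrite -/y; case: e01 => ->; rewrite mulrC divfK// addrAC subrr add0r ?rpred0 ?rpred1.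
  have c1 : cos (2 * pi * ((y + 1) / 2) + phi n) = - cos (2 * pi * ((y + 0) / 2) + phi n).
    by rewrite -cosDpi; congr cos; lra.
  (* Passing from [e = 0] to [e = 1] moves [pi * w e] by an odd multiple of [pi / 2], since [b 0] is
     a sign and [c l] is odd. *)
  have w1 : `|cos (pi * w 1 + phi (n + l)%N)| = `|sin (pi * w 0 + phi (n + l)%N)|.
    have [j jE] : exists j : int, - b 0 * c l = 2 * j + 1.
      have [b1|b1] : b 0 = 1 \/ b 0 = -1.
        have : (b 0 - 1) * (b 0 + 1) = 0 by rewrite -[RHS](subrr (1 : int)) -{3}bb; ring.
        by move/eqP; rewrite mulf_eq0 => /orP[] /eqP ?; [left|right]; lia.
      - by exists (- k - 1); rewrite b1 cl; lia.
      - by exists k; rewrite b1 cl; lia.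
    rewrite -(abs_cos_odd_shift _ j) -jE; congr `|cos _|.
    by rewrite /w intrM intrN; lra.
  have cs := abs_cos_sin_ge1 (pi * w 0 + phi (n + l)%N).
  have := ler_wpM2l (a0 (n + l)%N) cs; rewrite mulr1 -w1 => cs'.
  (* The terms in [a n] of the two choices cancel, so the choices together yield at least
     [a (n + l)], and one of them reaches half of it. *)
  have [g0|g0] := leP (a (n + l)%N / 2) (a n * cos (2 * pi * ((y + 0) / 2) + phi n) +
       a (n + l)%N * `|cos (pi * w 0 + phi (n + l)%N)|).
    by apply: (goal 0); [left|].
  by apply: (goal 1); [right|rewrite c1; lra].
pose x n := (z n).1; pose y := yw (fun m => (z m).2).
have yl n : y (n + l)%N = (z n).2 by rewrite /y /yw ltnNge leq_addl/= addnK.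
exists x, y; split.
- move=> n.
  have split3 (g : 'I_s.+1 -> R) : \sum_d g d = \sum_(d < s.+1 | (d < l)%N) g d +
      \sum_(d < s.+1 | (l <= d)%N) g d.
    by rewrite (bigID (fun d : 'I__ => (d < l)%N)); congr (_ + _); apply: eq_bigl => d; rewrite -leqNgt.
  rewrite split3.
  (* Subtracting this exact identity leaves the terms [b d] times [2 x - y] at lag [d], all of them
     integers. *)
  suff E : \sum_(d < s.+1 | (d < l)%N) (b d)%:~R * lag y n d +
      \sum_(d < s.+1 | (l <= d)%N) (c d)%:~R * lag x n d = 0 :> R.
    have -> : \sum_(d < s.+1 | (d < l)%N) (c d)%:~R * lag x n d +
      \sum_(d < s.+1 | (l <= d)%N) (c d)%:~R * lag x n d =
      \sum_(d < s.+1 | (d < l)%N) (b d)%:~R * (2 * lag x n d - lag y n d).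
      transitivity (\sum_(d < s.+1 | (d < l)%N) (c d)%:~R * lag x n d -
        \sum_(d < s.+1 | (d < l)%N) (b d)%:~R * lag y n d); first by move: E; lra.
      rewrite -sumrB.
      by apply: eq_bigr => d dl; rewrite cb// intrM; lra.
    apply: rpred_sum => d _; rewrite rpredM ?intr_int// /lag; case: ifP => _.
      by have [] := zP (n - d)%N.
    by rewrite mulr0 subrr rpred0.
  (* Before time [l] both sums vanish: [y] is 0 there, and lags [d >= l] reach back beyond time
     0. *)
  have [nl|ln] := ltnP n l.
    rewrite !big1 ?addr0// => d hd; rewrite /lag; case: ifP => dn; rewrite ?mulr0//.
      by have := leq_trans hd dn; rewrite leqNgt nl.
    by rewrite /y /yw (leq_ltn_trans (leq_subr d n) nl) mulr0.
  set m := (n - l)%N; have nE : n = (m + l)%N by rewrite subnK.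
  have [_ + _ _] := zP m; rewrite -yl -nE => yE.
  have b0E : (b 0)%:~R * (b 0)%:~R = 1 :> R by rewrite -intrM bb.
  rewrite (bigD1 (ord0 : 'I_s.+1))//= lag0.
  have ls' : (l < s.+1)%N by [].
  rewrite (bigD1 (Ordinal ls') (P := fun d : 'I_s.+1 => (l <= d)%N))//=.
  have -> : lag x n l = (z m).1 by rewrite /lag ln.
  rewrite yE /rest !mulrDr.
  set A := \sum_(d < s.+1 | (d < l)%N && _) _.
  set D := \sum_(d < s.+1 | (l <= d)%N && _) _.
  set A' := \sum_(d < s.+1 | _) _; set D' := \sum_(d < s.+1 | _) _.
  have -> : A = A'.
    apply: eq_big => [d|d /andP[dl d0]]; first by rewrite andbC lt0n.
    congr (_ * _); rewrite /lag nE; case: leqP => dml; case: leqP => dm//.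
    - by rewrite -yl; congr y; lia.
    - by rewrite /y /yw ifT//; lia.
    - by exfalso; lia.
  have -> : D = D'.
    apply: eq_big => [d|d /andP[dl d0]].
      by rewrite ltn_neqAle andbC eq_sym.
    congr (_ * _); rewrite /lag nE.
    have -> : (d <= m + l)%N = (d - l <= m)%N by lia.
    by case: ifP => // _; congr (_ .1); congr z; lia.
  have := congr1 (fun u => u * (A' + D' + (c l)%:~R * (z m).1)) b0E; lra.
- by move=> n Hn; have [_ _ + _] := zP n; exact.
- by move=> n Hn; have [_ _ _] := zP n; rewrite yl; exact.
Qed.

End causal_solutions.

Lemma int_parity (z : int) : exists k, z = 2 * k + (odd `|z|%N)%:Z.
Proof.
have [k [E|E]] : exists k, z = 2 * k \/ z = 2 * k + 1.
  exists (z %/ 2)%Z; have := divz_eq z 2; have := modz_ge0 z (isT : (2 : int) != 0).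
  by have := ltz_pmod z (isT : (0 : int) < 2); lia.
- by exists k; lia.
- by exists k; lia.
Qed.

(** * Solutions correlated with a weight, for a leading coefficient of modulus at least 2 *)

Section coherent.
Variable R : realType.
Variables (F : {poly int}) (a phi : nat -> R) (M delta : R).

(* The weight is [w n = a n e^(i phi n)]; the condition on [beta] bounds from below the real
   part of [e^(i beta)] times the sum of the [w n e^(2 pi i X n)], and [X] modulo 1 is, up to a
   shift, a point of the principal action of [F]. *)
Definition coherent := exists X : int -> R,
  (forall n : int, \sum_(i < size F) (F`_i)%:~R * X (n + i%:Z) \is a Num.int) /\
  exists beta c1 : R, 0 < c1 /\ frequently (fun N => c1 * N%:R <=
     \sum_(n < N) a n * cos (2 * pi * X n%:Z + phi n + beta)).

Hypothesis a0M : forall n, 0 <= a n <= M.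
Hypothesis delta0 : 0 < delta.
Hypothesis a_freq : frequently (fun N => delta * N%:R <= \sum_(n < N) a n).

Let a0 n : 0 <= a n. Proof. by have /andP[] := a0M n. Qed.
Let M0 : 0 <= M. Proof. by have /andP[h1 h2] := a0M 0; exact: le_trans h2. Qed.

Lemma coherent_lead_ge3 : 3 <= `|lead_coef F| -> coherent.
Proof.
move=> F3; have sF : size F = (size F).-1.+1.
  case E : (size F) => [|//]; move: F3.
  by rewrite /lead_coef E nth_default ?E// normr0.
have := @causal_lead_ge3 R (fun d => F`_((size F).-1 - d)) (size F).-1 phi.
rewrite subn0 -sF => /(_ F3)[x [xZ xc]].
exists (extend0 x); split; first exact: causal_solution.
have c3 := cos_pi3_gt0 R.
exists 0, (cos (pi / 3) * delta); split; first by rewrite mulr_gt0.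
apply: frequently_impl a_freq => N /(ler_wpM2l (ltW c3)).
rewrite mulrA => /le_trans; apply; rewrite mulr_sumr; apply: ler_sum => n _.
rewrite addr0 [X in X <= _]mulrC ler_wpM2l//; exact: xc.
Qed.

(** As all coefficients are even, every sequence with values 0 and 1/2 is a solution, and a suitable
    one turns each cosine into its absolute value. The angles 0 and [- (pi / 2)] for [beta] test the
    real and the imaginary part, which together dominate the sum of [a]. *)
Lemma coherent_even : (forall i, ~~ odd `|F`_i|) -> coherent.
Proof.
move=> Feven.
pose psi (beta : R) n := phi n + beta.
have sol beta : exists X : int -> R, (forall n : int, \sum_(i < size F) (F`_i)%:~R * X (n + i%:Z) \is a Num.int) /\
    forall n : nat, cos (2 * pi * X n + phi n + beta) = `|cos (phi n + beta)|.
  exists (fun n : int => if 0 <= cos (phi `|n|%N + beta) then 0 else 1 / 2); split => n.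
    apply: rpred_sum => i _; have [k ->] := int_parity F`_i.
    rewrite (negbTE (Feven i)) addr0 intrM; case: ifP => _; first by rewrite mulr0 rpred0.
    by rewrite mulrAC mul1r divff// mul1r intr_int.
  have -> : `|n%:Z|%N = n by [].
  have [c0|c0] := leP 0 (cos (phi n + beta)).
    by rewrite mulr0 add0r ger0_norm.
  rewrite ltr0_norm// -cosDpi; congr cos; lra.
have [f1|f2] : frequently (fun N => delta / 2 * N%:R <= \sum_(n < N) a n * `|cos (phi n)|) \/
   frequently (fun N => delta / 2 * N%:R <= \sum_(n < N) a n * `|cos (phi n - pi / 2)|).
- apply/frequently_or; apply: frequently_impl a_freq => N dN.
  have : \sum_(n < N) a n <= \sum_(n < N) a n * `|cos (phi n)| +
      \sum_(n < N) a n * `|cos (phi n - pi / 2)|.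
    rewrite -big_split; apply: ler_sum => n _ /=.
    by rewrite -mulrDr cosBpihalf ler_peMr// abs_cos_sin_ge1.
  set A := \sum_(n < N) a n * `|cos (phi n)|; set B := \sum_(n < N) _ * _ => AB.
  have [h|h] := leP (delta / 2 * N%:R) A; first by left.
  by right; lra.
- have [X [XZ Xc]] := sol 0; exists X; split => //; exists 0, (delta / 2).
  split; first by rewrite divr_gt0.
  apply: frequently_impl f1 => N /le_trans; apply; apply: ler_sum => n _.
  by rewrite Xc addr0.
- have [X [XZ Xc]] := sol (- (pi / 2)); exists X; split => //; exists (- (pi / 2)), (delta / 2).
  split; first by rewrite divr_gt0.
  apply: frequently_impl f2 => N /le_trans; apply; apply: ler_sum => n _.
  by rewrite Xc.
Qed.

Lemma coherent_odd i0 : `|lead_coef F| = 2 -> odd `|F`_i0| -> coherent.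
Proof.
move=> F2 Fi0; have sF : size F = (size F).-1.+1.
  case E : (size F) => [|//]; move: F2.
  by rewrite /lead_coef E nth_default ?E// normr0.
set s := (size F).-1 in sF.
pose c d := F`_(s - d).
have c0E : c 0%N = lead_coef F by rewrite /c subn0.
have i0s : (i0 <= s)%N.
  rewrite leqNgt; apply/negP => si; move: Fi0.
  by rewrite nth_default// sF.
have ex_odd : exists d, odd `|c d| by exists (s - i0)%N; rewrite /c subKn.
pose l := ex_minn ex_odd.
have [lodd lmin] : odd `|c l| /\ forall d, odd `|c d| -> (l <= d)%N.
  by rewrite /l; case: ex_minnP.
have l0 : (0 < l)%N.
  rewrite lt0n; apply/negP => /eqP l0; move: lodd; rewrite l0 c0E.
  by have -> : `|lead_coef F|%N = 2%N by lia.
have ls : (l <= s)%N.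
  apply: leq_trans (lmin (s - i0)%N _) (leq_subr _ _).
  by rewrite /c subKn.
have [b bE] : exists b : nat -> int, forall d, c d = 2 * b d + (odd `|c d|)%:Z.
  by have [b] := choice (fun d => int_parity (c d)); exists b.
have cb d : (d < l)%N -> c d = 2 * b d.
  move=> dl; rewrite {1}bE; have -> : odd `|c d| = false; last by rewrite addr0.
  by apply: contraTF dl => /lmin; rewrite leqNgt.
have bb : b 0%N * b 0%N = 1.
  have := cb 0%N l0; rewrite c0E => lE; move: F2; rewrite lE => F2.
  by have [->|->] : b 0%N = 1 \/ b 0%N = -1 by lia.
have cl : c l = 2 * b l + 1 by rewrite {1}bE lodd.
(* Blocks of length [l] alternate: at [H2] times a gain is collected, at the other times the phase
   [l] steps later is steered. The bit [p] is chosen so that the [H2] times frequently carry mass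
   [delta / 2 * N] of [a]. *)
pose H2 p n := odd (n %/ l) (+) p.
pose K p n := if H2 p n then a n else 0.
have [p pP] : exists p, frequently (fun N => delta / 2 * N%:R <= \sum_(n < N) K p n).
  suff : frequently (fun N => delta / 2 * N%:R <= \sum_(n < N) K true n) \/
      frequently (fun N => delta / 2 * N%:R <= \sum_(n < N) K false n).
    by case; [exists true|exists false].
  apply: frequently_or; apply: frequently_impl a_freq => N dN.
  have E : \sum_(n < N) a n = \sum_(n < N) K true n + \sum_(n < N) K false n.
    rewrite -big_split; apply: eq_bigr => n _; rewrite /K /H2 addbT addbF /=.
    by case: odd; rewrite /= ?addr0 ?add0r.
  have [h|h] := leP (delta / 2 * N%:R) (\sum_(n < N) K true n); first by left.
  by right; move: h dN; rewrite E; lra.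
have lls : (0 < l <= s)%N by rewrite l0.
have [x [y [xZ xH2 xH1]]] := @causal_lead2 R c s l b (b l) a phi p lls bb cb cl a0.
exists (extend0 x); split.
  by apply: causal_solution => n; rewrite sF; exact: xZ.
exists 0, (delta / 8); split; first by rewrite divr_gt0.
(* [G] is the gain at [H2] times. In [key] it enters at [n] and, negatively, at [n + l], so its sum
   cancels up to boundary terms and half of [K] remains. *)
pose G n := if H2 p n then a n * `|cos (pi * y n + phi n)| else 0.
have K0M n : 0 <= K p n <= M by rewrite /K; case: ifP; rewrite ?lexx ?M0.
have G0M n : 0 <= G n <= M.
  rewrite /G; case: ifP; rewrite ?lexx ?M0// mulr_ge0//= => _.
  have /andP[_ aM] := a0M n; apply: le_trans aM.
  by rewrite ler_piMr// cos_max.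
have H2l n : H2 p (n + l)%N = ~~ H2 p n.
  by rewrite /H2 divnDr// divnn l0 addn1 /= addNb.
have key n : K p (n + l)%N / 2 - G (n + l)%N + G n <= a n * cos (2 * pi * x n + phi n).
  rewrite /K /G H2l; have [Hn|Hn] := boolP (H2 p n) => /=.
    by rewrite mul0r subrr add0r xH2.
  by have := xH1 n Hn; lra.
(* The boundary terms cost at most [3 / 2 * l * M], which the constant 12 makes at most
   [delta * N / 8]. *)
have [n0 n0P] := exists_nat_ge (12 * l%:R * M / delta).
apply: frequently_impl (frequently_large n0 pP) => N [n0N KN].
apply: (@le_trans _ _ (\sum_(n < N) (K p (n + l)%N / 2 - G (n + l)%N + G n))); last first.
  by apply: ler_sum => n _; rewrite addr0.
rewrite big_split sumrB -mulr_suml /=.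
have /andP[k1 _] := sum_shift_bounds l N K0M.
have /andP[_ g1] := sum_shift_bounds l N G0M.
have nN : n0%:R <= N%:R :> R by rewrite ler_nat.
have : 12 * l%:R * M <= N%:R * delta.
  by rewrite -ler_pdivrMr//; exact: le_trans nN.
by move: KN k1 g1; lra.
Qed.

Lemma coherent_lead_ge2 : 2 <= `|lead_coef F| -> coherent.
Proof.
move=> F2; have [F3|F3] := leP 3 `|lead_coef F|; first exact: coherent_lead_ge3.
have [all_even|] := pselect (forall i, ~~ odd `|F`_i|); first exact: coherent_even.
move=> /existsNP[i /negP]; rewrite negbK; apply: coherent_odd; lia.
Qed.

End coherent.

(** * Jensen's inequality *)

Section periodic_integral.
Variable R : realType.
Local Open Scope classical_set_scope.
Local Open Scope ring_scope.
Local Open Scope ereal_scope.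
Local Notation mu := (@lebesgue_measure R).
Local Notation shr s := (fun t : measurableTypeR R => (t + s)%R : measurableTypeR R).

Lemma measurable_shift (s : R) : measurable_fun setT (shr s).
Proof.
apply: continuous_measurable_fun => t.
by apply: cvgD; [exact: cvg_id|exact: cvg_cst].
Qed.

Lemma shift_preimage_itv (s a b : R) b0 b1 :
  shr s @^-1` [set` Interval (BSide b0 a) (BSide b1 b)] =
  [set` Interval (BSide b0 (a - s)%R) (BSide b1 (b - s)%R)].
Proof.
apply/seteqP; split => t /=; rewrite !itv_boundlr;
  by case: b0 b1 => -[] /=; rewrite !bnd_simp ?lerBlDr ?lerBrDr ?ltrBlDr ?ltrBrDr.
Qed.

Lemma lebesgue_measure_shift (s : R) (A : set R) : measurable A ->
  pushforward mu (shr s) A = mu A.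
Proof.
move=> mA; have mf := measurable_shift s.
pose f : {mfun measurableTypeR R >-> measurableTypeR R} :=
  HB.pack (shr s) (isMeasurableFun.Build _ _ _ _ _ mf).
apply/esym; rewrite -[RHS]/(pushforward mu f A).
apply: lebesgue_measure_unique => //= _ [[a b]] _ <-.
rewrite /pushforward /= shift_preimage_itv !lebesgue_measure_itv/=.
by rewrite !lte_fin ltrD2r -!EFinB opprB addrA subrK.
Qed.

Lemma ge0_integral_shift (s a b : R) b0 b1 (f : R -> \bar R) :
  measurable_fun setT f -> (forall r, 0 <= f r) ->
  \int[mu]_(t in [set` Interval (BSide b0 a) (BSide b1 b)]) f (t + s)%R =
  \int[mu]_(t in [set` Interval (BSide b0 (a + s)%R) (BSide b1 (b + s)%R)]) f t.
Proof.
move=> mf f0.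
have := shift_preimage_itv s (a + s)%R (b + s)%R b0 b1; rewrite !addrK => <-.
rewrite -[LHS]/(\int[mu]_(t in shr s @^-1` _) (f \o shr s) t).
rewrite -(ge0_integral_pushforward (measurable_shift s))//=.
  apply: eq_measure_integral => [|mshift A mA _]; first exact: measurable_shift.
  exact: lebesgue_measure_shift.
exact: measurable_funS mf.
Qed.

Lemma ge0_integral_periodic (s : R) (f : R -> \bar R) : (0 <= s <= 1)%R ->
  measurable_fun setT f -> (forall r, 0 <= f r) -> (forall r, f (r + 1)%R = f r) ->
  \int[mu]_(t in `[0%R, 1%R[) f (t + s)%R = \int[mu]_(t in `[0%R, 1%R[) f t.
Proof.
move=> /andP[s0 s1] mf f0 fp.
rewrite ge0_integral_shift// add0r.
have split_itv (a b c : R) : (a <= b)%R -> (b <= c)%R ->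
   \int[mu]_(t in `[a, c[) f t = \int[mu]_(t in `[a, b[) f t + \int[mu]_(t in `[b, c[) f t.
  move=> ab bc; rewrite (@itv_bndbnd_setU _ _ (BLeft a) (BLeft b) (BLeft c))//.
  rewrite ge0_integral_setU//; first exact: measurable_funS mf.
  apply/disj_setPS => t [] /=; rewrite !in_itv/= => /andP[_ tb] /andP[bt _].
  by move: (le_lt_trans bt tb); rewrite ltxx.
rewrite (split_itv s 1%R)//; last by rewrite lerDl.
rewrite (split_itv 0%R s 1%R)// addeC; congr (_ + _).
have := @ge0_integral_shift 1 0 s true true f mf f0; rewrite add0r addrC => <-.
by apply: eq_integral => t _; rewrite fp.
Qed.

End periodic_integral.

(** * The mean of a logarithm under halving of the period *)

Section jensen.
Variable R : realType.
Local Open Scope classical_set_scope.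
Local Open Scope ring_scope.
Local Open Scope ereal_scope.
Local Notation mu := (@lebesgue_measure R).

Lemma measurable_lne_comp (f : R -> R) : measurable_fun setT f ->
  measurable_fun setT (fun t => lne (f t)%:E).
Proof.
move=> mf; rewrite /lne; apply: measurable_fun_ifT.
- exact: measurable_fun_ler.
- exact: measurable_cst.
- by apply/measurable_EFinP; apply: measurableT_comp => //; exact: measurable_ln.
Qed.

Lemma lne_le_ln (x K : R) : (0 <= x <= K)%R -> (0 < K)%R -> lne x%:E <= (ln K)%:E.
Proof.
move=> /andP[x0 xK] K0; have [xle0|xgt0] := leP x 0%R; first by rewrite le0_lneNy// leNye.
by rewrite lne_EFin// lee_fin ler_ln ?posrE.
Qed.

(* The functions [f k] come from a product formula under halving the period; each halving
   doubles the distance from [ln K] of the mean of [ln K - lne (f k)], which stays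
   nonnegative. *)
Lemma integral_lne_le0 (f : nat -> R -> R) (K : R) (tau : nat -> R) :
  (1 <= K)%R -> (forall k, continuous (f k)) -> (forall k t, 0 <= f k t <= K)%R ->
  (forall k t, f k (t + 1) = f k t)%R -> (forall k, 0 <= tau k <= 1)%R ->
  (forall k t, f k t * f k (t + tau k) = f k.+1 t)%R ->
  \int[mu]_(t in `[0%R, 1%R]) lne (f 0%N t)%:E <= 0.
Proof.
move=> K1 cf f0K fper tau01 fM.
have K0 : (0 < K)%R by exact: lt_le_trans K1.
set C := ln K; have C0 : (0 <= C)%R by exact: ln_ge0.
pose D : set R := `[0%R, 1%R[%classic.
have mD : measurable D by exact: measurable_itv.
have muD : mu D = 1 by rewrite /D lebesgue_measure_itv/= lte_fin ltr01 -EFinB subr0.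
pose L k t := lne (f k t)%:E; pose H k t := C%:E - L k t.
have LC k t : L k t <= C%:E by exact: lne_le_ln.
have mL k : measurable_fun setT (L k).
  by apply: measurable_lne_comp; exact: continuous_measurable_fun.
have mH k : measurable_fun setT (H k).
  by apply: emeasurable_funB => //; exact: measurable_cst.
have H0 k t : 0 <= H k t by rewrite /H sube_ge0 ?orbT.
(* The product formula makes the distances from [C] additive up to one extra [C]; at a zero of
   either factor both sides are infinite. *)
have HM k t : H k t + H k (t + tau k)%R = C%:E + H k.+1 t.
  rewrite /H /L -fM.
  have /andP[x0 _] := f0K k t; have /andP[y0 _] := f0K k (t + tau k)%R.
  move: x0 y0; set x := f k t; set y := f k _.
  rewrite le_eqVlt => /predU1P[<-|x0].
    move=> y0; rewrite mul0r [lne 0%:E]le0_lneNy//= addye//.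
    by case: (y <= 0)%R.
  rewrite le_eqVlt => /predU1P[<-|y0].
    by rewrite mulr0 [lne 0%:E]le0_lneNy// lne_EFin.
  rewrite !lne_EFin ?mulr_gt0// lnM ?posrE// -!EFinB -!EFinD; congr (_%:E); lra.
pose I k := \int[mu]_(t in D) H k t.
have I_ge0 k : 0 <= I k by apply: integral_ge0 => t _; exact: H0.
have intC : \int[mu]_(t in D) C%:E = C%:E.
  by transitivity (C%:E * mu D); [exact: integral_cst|rewrite muD mule1].
have I_double k : I k + I k = C%:E + I k.+1.
  have -> : C%:E + I k.+1 = \int[mu]_(t in D) (C%:E + H k.+1 t).
    by rewrite ge0_integralD//; [rewrite intC|exact: measurable_funS (mH _)].
  have Hper t : H k (t + 1)%R = H k t by rewrite /H /L fper.
  have Ishift : \int[mu]_(t in D) H k (t + tau k)%R = I k.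
    exact: ge0_integral_periodic.
  rewrite -{2}Ishift -ge0_integralD//; first by apply: eq_integral => t _; rewrite HM.
  - exact: measurable_funS (mH _).
  - apply: (@measurable_funS _ _ _ _ setT) => //.
    by apply: measurableT_comp (mH k) _; exact: measurable_shift.
(* [I k - C] doubles at each step, so a negative start would make some [I k] negative. *)
have CI : C%:E <= I 0%N.
  rewrite leNgt; apply/negP => IC.
  have [x [x0 xE]] : exists x : nat -> R, (x 0%N < C)%R /\ forall k, I k = (x k)%:E.
    suff fin k : I k \is a fin_num.
      exists (fun k => fine (I k)); split; last by move=> k; rewrite fineK.
      by rewrite -lte_fin fineK.
    elim: k => [|k IH].
      by rewrite ge0_fin_numE// (lt_trans IC)// ltry.
    have : C%:E + I k.+1 \is a fin_num by rewrite -I_double fin_numD IH.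
    by rewrite fin_numD => /andP[].
  have xk k : (x k = C + 2 ^+ k * (x 0%N - C))%R.
    elim: k => [|k IH]; first by rewrite expr0 mul1r addrC subrK.
    have := I_double k; rewrite !xE -!EFinD => -[]; rewrite IH exprS; lra.
  have two1 : (1 < 2 :> R)%R by rewrite ltr1n.
  have [n nP] := exp_unbounded (1 + C / (C - x 0%N)) two1.
  have d0 : (0 < C - x 0%N)%R by rewrite subr_gt0.
  have := I_ge0 n; rewrite xE lee_fin xk.
  have := ler_wpM2r (ltW d0) nP; rewrite mulrDl divfK ?gt_eqF//; lra.
have Lp_le t : (L 0%N)^\+ t <= C%:E by rewrite funeposE ge_max LC lee_fin.
have mLp : measurable_fun setT (L 0%N)^\+ by exact: measurable_funepos.
have mLn : measurable_fun setT (L 0%N)^\- by exact: measurable_funeneg.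
have mCLp : measurable_fun setT (fun t => C%:E - (L 0%N)^\+ t).
  by apply: emeasurable_funB => //; exact: measurable_cst.
have CLp0 t : 0 <= C%:E - (L 0%N)^\+ t.
  by rewrite sube_ge0 ?orbT//; exact: Lp_le.
have Lp_fin t : (L 0%N)^\+ t \is a fin_num.
  by rewrite ge0_fin_numE ?funepos_ge0// (le_lt_trans (Lp_le t))// ltry.
rewrite -integral_itv_bndo_bndc; last exact: measurable_funS (mL 0%N).
rewrite -/D integralE.
set p := \int[mu]_(t in D) _^\+ t; set n := \int[mu]_(t in D) _^\- t.
(* The negative part of [L 0] is not known to be integrable, so it is compared through [q]: from
   [q + p = C] and [q + n = I 0 >= C] with [q] finite follows [p <= n]. *)
pose q := \int[mu]_(t in D) (C%:E - (L 0%N)^\+ t).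
have pq : q + p = C%:E.
  rewrite -ge0_integralD//; last 2 first.
  - exact: measurable_funS mCLp.
  - exact: measurable_funS mLp.
  rewrite -[RHS]intC; apply: eq_integral => t _.
  by rewrite subeK.
have qn : I 0%N = q + n.
  rewrite -ge0_integralD//; last 2 first.
  - exact: measurable_funS mCLp.
  - exact: measurable_funS mLn.
  apply: eq_integral => t _.
  have L_split (x : \bar R) : x <= C%:E -> C%:E - x = C%:E - maxe x 0 + maxe (- x) 0.
    case: x => [r _|//|_]; last by rewrite maxNye maxye.
    rewrite -EFinN -!EFin_max -!EFinB -EFinD; congr (_%:E).
    by rewrite /Num.max; case: ltP => r0; case: ltP => r1; lra.
  by rewrite /H (L_split _ (LC 0%N t)) funeposE funenegE.
have q0 : 0 <= q by apply: integral_ge0 => t _; exact: CLp0.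
have p0 : 0 <= p by apply: integral_ge0 => t _; exact: funepos_ge0.
have qfin : q \is a fin_num.
  by rewrite ge0_fin_numE// (@le_lt_trans _ _ C%:E) ?ltry// -pq leeDl.
by rewrite sube_le0 -(leeD2lE _ _ qfin) pq -qn.
Qed.

End jensen.

(** * The exponential on the unit circle and products over roots *)

Section unit_circle.
Variable R : realType.
Implicit Types (s t : R).

Definition expi t : R[i] := Complex (cos (2 * pi * t)) (sin (2 * pi * t)).

Lemma expiD s t : expi (s + t) = expi s * expi t.
Proof. by rewrite /expi mulrDr cosD sinD [X in Complex _ X]addrC. Qed.

Lemma normc_expi t : normc (expi t) = 1.
Proof. by rewrite /= cos2Dsin2 sqrtr1. Qed.

Lemma expi_half t : expi (t + 1 / 2) = - expi t.
Proof.
rewrite /expi; have -> : 2 * pi * (t + 1 / 2) = 2 * pi * t + pi by lra.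
by rewrite cosDpi sinDpi.
Qed.

Lemma expi_nat t n : expi (t + n%:R) = expi t.
Proof.
elim: n => [|n IH]; first by rewrite addr0.
have -> : t + n.+1%:R = t + n%:R + 1 / 2 + 1 / 2 by rewrite -natr1; lra.
by rewrite !expi_half opprK.
Qed.

Lemma expi_int t (n : int) : expi (t + n%:~R) = expi t.
Proof.
case: n => n; first exact: expi_nat.
by rewrite NegzE mulrNz -[in RHS](subrK n.+1%:R t) expi_nat.
Qed.

Lemma continuous_cos2pi s : continuous (fun t : R => cos (2 * pi * (s * t))).
Proof.
move=> t; apply: (@cvg_comp _ _ _ _ (@cos R)); last exact: continuous_cos.
by apply: cvgMl_tmp; apply: cvgMl_tmp; exact: cvg_id.
Qed.

Lemma continuous_sin2pi s : continuous (fun t : R => sin (2 * pi * (s * t))).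
Proof.
move=> t; apply: (@cvg_comp _ _ _ _ (@sin R)); last exact: continuous_sin.
by apply: cvgMl_tmp; apply: cvgMl_tmp; exact: cvg_id.
Qed.

Lemma continuous_normc_expiB s (r : R[i]) :
  continuous (fun t : R => normc (expi (s * t) - r)).
Proof.
case: r => a b t; apply: (@cvg_comp _ _ _
  (fun t : R => (cos (2 * pi * (s * t)) - a) ^+ 2 + (sin (2 * pi * (s * t)) - b) ^+ 2)
  (@Num.sqrt R)); last exact: sqrt_continuous.
apply: cvgD; apply: (@cvg_comp _ _ _ _ (fun x : R => x ^+ 2)); try exact: exprn_continuous.
- by apply: cvgB; [exact: continuous_cos2pi|exact: cvg_cst].
- by apply: cvgB; [exact: continuous_sin2pi|exact: cvg_cst].
Qed.

(** With [e(t)] for [expi t], the identity [|e(t) - r| |e(t + 1/2) - r| = |e(2 t) - r^2|] halves the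
    period. The points [r ^+ (2 ^ k)] stay in the unit disc, so [2 ^+ size rs] bounds all the
    [f k]. *)
Lemma integral_lne_prod_le0 (rs : seq R[i]) : (forall r, r \in rs -> normc r <= 1) ->
  (\int[lebesgue_measure]_(t in `[0%R, 1%R]%classic)
    lne (\prod_(r <- rs) normc (expi t - r))%:E <= 0)%E.
Proof.
move=> rs1.
pose f k t := \prod_(r <- rs) normc (expi (2 ^+ k * t) - r ^+ (2 ^ k)).
have := @integral_lne_le0 R f (2 ^+ size rs) (fun k => (2 ^+ k.+1)^-1).
rewrite (_ : f 0%N = fun t => \prod_(r <- rs) normc (expi t - r)); last first.
  by apply/funext => t; apply: eq_bigr => r _; rewrite mul1r expr1.
apply.
- by rewrite exprn_ege1// ler1n.
- move=> k; rewrite /f; elim: rs {rs1 f} => [|r rs IH] t.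
    by under eq_fun do rewrite big_nil; exact: cvg_cst.
  under eq_fun do rewrite big_cons.
  by apply: cvgM; [exact: continuous_normc_expiB|exact: IH].
- move=> k t; apply/andP; split; first by apply: prodr_ge0 => r _; exact: normc_ge0.
  have -> : 2 ^+ size rs = \prod_(r <- rs) 2 :> R.
    by rewrite big_const_seq count_predT -Monoid.iteropE.
  rewrite /f !big_seq; apply: ler_prod => r /rs1 r1; rewrite normc_ge0/=.
  apply: le_trans (ler_normcD _ _) _; rewrite normc_opp normc_expi normc_exp.
  by rewrite (_ : 2 = 1 + 1)// lerD2l exprn_ile1// normc_ge0.
- move=> k t; apply: eq_bigr => r _; rewrite mulrDr mulr1.
  by have := expi_nat (2 ^+ k * t) (2 ^ k)%N; rewrite natrX => ->.
- move=> k; rewrite invr_ge0 exprn_ge0//= invf_le1 ?exprn_gt0//.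
  by rewrite exprn_ege1// ler1n.
- move=> k t; rewrite /f -big_split; apply: eq_bigr => r _ /=.
  have -> : 2 ^+ k * (t + (2 ^+ k.+1)^-1) = 2 ^+ k * t + 1 / 2.
    by rewrite exprS; field; rewrite expf_neq0.
  have -> : 2 ^+ k.+1 * t = 2 ^+ k * t + 2 ^+ k * t by rewrite exprS; lra.
  rewrite expi_half expiD -ComplexField.Normc.normcM -[in RHS]normc_opp expnS mulnC exprM.
  congr normc; ring.
Qed.

Lemma mahler_monic_le0 (F : {poly int}) : `|lead_coef F| = 1 ->
  (forall r, root (map_poly (intr : int -> R[i]) F) r -> normc r <= 1) ->
  (\int[lebesgue_measure]_(t in `[0%R, 1%R]%classic)
    lne (normc (map_poly (intr : int -> R[i]) F).[expi t])%:E <= 0)%E.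
Proof.
move=> F1 Froots; set p := map_poly _ F.
have [rs pE] := closed_field_poly_normal p.
have lead1 : normc (lead_coef p) = 1.
  have lE : lead_coef p = (lead_coef F)%:~R.
    rewrite lead_coef_map_inj//; exact: intr_inj.
  rewrite lE; have [->|->] : lead_coef F = 1 \/ lead_coef F = -1 by lia.
    by rewrite ComplexField.Normc.normc1.
  by rewrite mulrN1z normc_opp ComplexField.Normc.normc1.
have p0 : p != 0 by rewrite -lead_coef_eq0; apply: contra_eq_neq lead1 => ->;
  rewrite ComplexField.Normc.normc0 eq_sym oner_neq0.
have rs1 r : r \in rs -> normc r <= 1.
  move=> rrs; apply: Froots; rewrite -/p pE rootZ ?lead_coef_eq0//.
  by rewrite root_prod_XsubC.
have := integral_lne_prod_le0 rs1; congr (is_true (_ <= _)%E).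
apply: eq_integral => t _; congr (lne _%:E).
rewrite pE hornerZ ComplexField.Normc.normcM lead1 mul1r horner_prod.
rewrite (big_morph _ (@ComplexField.Normc.normcM R) (ComplexField.Normc.normc1 R)).
by apply: eq_bigr => r _; rewrite !hornerE.
Qed.

End unit_circle.

(** * Correlated solutions from an expanding root *)

Section expanding_root.
Variable R : realType.

Lemma Re_mul_int (z : R[i]) (k : int) : complex.Re (k%:~R * z) = k%:~R * complex.Re z.
Proof.
have -> : (k%:~R : R[i]) = (k%:~R : R)%:C by rewrite rmorph_int.
by case: z => x y /=; rewrite mul0r subr0.
Qed.

Lemma Re_sum (I : Type) (r : seq I) (P : pred I) (f : I -> R[i]) :
  complex.Re (\sum_(i <- r | P i) f i) = \sum_(i <- r | P i) complex.Re (f i).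
Proof. by apply: (big_morph (@complex.Re R)) => // -[? ?] [? ?]. Qed.

(** The real part of [lam ^ n * tau] solves the recurrence exactly over the reals, since [lam] is a
    root; [tau] is the point of [expanding_point] read as a complex number. *)
Lemma coherent_root (F : {poly int}) (a phi : nat -> R) (M delta : R) (lam : R[i]) :
  (forall n, 0 <= a n <= M) -> 0 < delta ->
  frequently (fun N => delta * N%:R <= \sum_(n < N) a n) ->
  root (map_poly (intr : int -> R[i]) F) lam -> 1 < normc lam -> coherent F a phi.
Proof.
move=> a0M delta0 a_freq Flam lam1.
have [t [c1 c10 ct]] := expanding_point phi lam1 a0M delta0 a_freq.
have lam0 : lam != 0.
  by apply: contraTneq lam1 => ->; rewrite ComplexField.Normc.normc0 ltr10.
pose tau : R[i] := Complex t.1 t.2.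
exists (fun n : int => complex.Re (lam ^ n * tau)); split.
  move=> n.
  have -> : \sum_(i < size F) (F`_i)%:~R * complex.Re (lam ^ (n + i%:Z) * tau) =
     complex.Re (lam ^ n * tau * (map_poly (intr : int -> R[i]) F).[lam]).
    rewrite horner_coef size_map_inj_poly//; last exact: intr_inj.
    rewrite mulr_sumr Re_sum; apply: eq_bigr => i _.
    rewrite -Re_mul_int coef_map_id0// expfzDr//; congr complex.Re; rewrite -exprnP; ring.
  by rewrite (rootP Flam) mulr0 rpred0.
exists 0, c1; split => //; apply: frequently_impl ct => N /le_trans; apply.
apply: ler_sum => n _; rewrite addr0 -exprnP /wave /tau.
by case: (lam ^+ n).
Qed.

End expanding_root.

(** [F] is [f] multiplied by a power of [z] that clears the negative exponents. The identity covers
    every abelian group, as it serves both for complex values of [f] and for points over the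
    circle. *)
Lemma laurent_poly (f : laurent) : f <> [fsfun with 0] ->
  exists (b : int) (F : {poly int}), F != 0 /\
    forall (V : zmodType) (v : int -> V),
      \sum_(m <- finsupp f) v m *~ f m = \sum_(i < size F) v (b + i%:Z) *~ F`_i.
Proof.
move=> f0.
pose B := (\max_(m <- finsupp f) `|m|)%N.
have suppB m : m \in finsupp f -> (`|m| <= B)%N.
  by move=> mf; rewrite /B (big_rem m)//= leq_maxl.
pose F := \poly_(i < (B + B).+1) f (- B%:Z + i%:Z).
have sumE (V : zmodType) (v : int -> V) :
    \sum_(m <- finsupp f) v m *~ f m = \sum_(i < size F) v (- B%:Z + i%:Z) *~ F`_i.
  have -> : \sum_(i < size F) v (- B%:Z + i%:Z) *~ F`_i =
      \sum_(i < (B + B).+1) v (- B%:Z + i%:Z) *~ F`_i.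
    rewrite (big_ord_widen _ (fun i : nat => v (- B%:Z + i%:Z) *~ F`_i) (size_poly _ _)).
    rewrite big_mkcond; apply: eq_bigr => i _; case: ltnP => // ?.
    by rewrite nth_default.
  transitivity (\sum_(i < (B + B).+1) v (- B%:Z + i%:Z) *~ f (- B%:Z + i%:Z)); last first.
    by apply: eq_bigr => i _; rewrite coef_poly ltn_ord.
  rewrite -(big_mkord predT (fun i : nat => v (- B%:Z + i%:Z) *~ f (- B%:Z + i%:Z))).
  rewrite -(big_map (fun i : nat => - B%:Z + i%:Z) predT (fun m => v m *~ f m)).
  set s := map _ _.
  rewrite [RHS](bigID (mem (finsupp f)))/= [X in _ + X]big1 ?addr0; last first.
    by move=> m; rewrite memNfinsupp => /eqP->; rewrite mulr0z.
  rewrite -[RHS]big_filter; apply: perm_big; apply: uniq_perm.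
  - exact: fset_uniq.
  - by rewrite filter_uniq// map_inj_uniq ?iota_uniq// => i j; lia.
  - move=> m; rewrite mem_filter; case: (boolP (m \in finsupp f)) => //= mf.
    have mB := suppB m mf; apply/esym/mapP; exists (absz (m + B%:Z)); last by lia.
    by rewrite mem_index_iota; lia.
exists (- B%:Z), F; split => //.
apply: contra_notN f0 => /eqP F0; apply/fsfunP => m; rewrite fsfun0E.
apply/eqP; rewrite -memNfinsupp; apply/negP => mf; move: (mf).
rewrite mem_finsupp; have mB := suppB m mf => /eqP; apply.
have := congr1 (fun p : {poly int} => p`_(absz (m + B%:Z))) F0.
rewrite /= coef0 coef_poly ifT; last by lia.
by move=> H; rewrite -[RHS]H; congr (f _); lia.
Qed.

(** * Correlation with a weight *)

Section limsup.
Variable R : realType.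
Local Open Scope classical_set_scope.
Local Open Scope ring_scope.

Lemma cesaro_limsup_gt0 (u : nat -> R) : (0 < cesaro_limsup u)%E <->
  exists2 c, 0 < c & frequently (fun N => c * N%:R <= u N).
Proof.
split=> [|[c c0 uc]].
- move=> u0; have [c c0 cu] : exists2 c : R, 0 < c & (c%:E < cesaro_limsup u)%E.
    move: u0; case: cesaro_limsup => [r|_|//]; last by exists 1; rewrite ?ltry.
    by rewrite lte_fin => r0; exists (r / 2); rewrite ?divr_gt0// lte_fin; lra.
  exists c => // N0.
  have : (c%:E < ereal_sup [set (N%:R^-1 * u N)%:E | N in [set N | (N0.+1 <= N)%N]])%E.
    apply: lt_le_trans cu _; apply: ereal_inf_lbound.
    by exists [set N | (N0.+1 <= N)%N] => //; exists N0.+1.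
  move=> /ereal_sup_gt[_ [N /= N0N <-]]; rewrite lte_fin => cN.
  have N_gt0 : 0 < N%:R :> R by rewrite ltr0n (leq_trans _ N0N).
  exists N; first exact: ltnW.
  by rewrite mulrC -ler_pdivlMl// ltW.
- apply: (@lt_le_trans _ _ c%:E); first by rewrite lte_fin.
  apply: le_ereal_inf_tmp => _ [V [N0 _ N0V] <-].
  have [N + cN] := uc (maxn N0 1); rewrite geq_max => /andP[N0N N1].
  have N_gt0 : 0 < N%:R :> R by rewrite ltr0n.
  apply: (@le_trans _ _ (N%:R^-1 * u N)%:E).
    by rewrite lee_fin ler_pdivlMl// mulrC.
  by apply: ereal_sup_ubound; exists N => //; exact: N0V.
Qed.

End limsup.

(** * The basic character of the circle *)

Section circle_character.
Variable R : realType.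
Local Open Scope quotient_scope.
Local Notation T := (circle R).

Definition circle_pi (x : R) : T := \pi_T x.

Lemma circle_pi_is_additive : zmod_morphism circle_pi.
Proof. by move=> x y; exact: circle_piB. Qed.

HB.instance Definition _ :=
  GRing.isZmodMorphism.Build R T circle_pi circle_pi_is_additive.

Lemma circle_pi_eq0 x : circle_pi x = 0 <-> x \is a Num.int.
Proof.
rewrite -(raddf0 circle_pi); rewrite -[X in _ <-> X \is a _](subr0 x).
exact: circle_pi_eq.
Qed.

(** Defined through a chosen representative; [characterE] shows that the choice does not matter. *)
Definition character (y : T) : R[i]^o := expi (repr y).

Lemma characterE x : character (circle_pi x) = expi x.
Proof.
have /circle_pi_eq/intrP[n nE] : \pi_T (repr (circle_pi x)) = \pi_T x :> T by rewrite reprK.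
by rewrite /character -[repr _](subrK x) nE addrC expi_int.
Qed.

Lemma continuous_expi : continuous (@expi R : R -> R[i]^o).
Proof.
move=> t; apply/cvgrPdist_lt => -[e e'] /=; rewrite ltcE /= => /andP[/eqP -> e0].
have := @continuous_normc_expiB R 1 (expi t) t.
rewrite /continuous_at mul1r subrr ComplexField.Normc.normc0 => /cvgrPdist_lt/(_ e e0).
apply: filterS => s; rewrite sub0r normrN mul1r ger0_norm ?normc_ge0// => se.
rewrite distrC; change (Complex (normc (expi s - expi t)) 0 < Complex e 0).
by rewrite ltcE /= eqxx.
Qed.

Lemma continuous_character : continuous character.
Proof.
apply/continuousP => A oA; rewrite /open/= /quotient_open.
rewrite (_ : _ @^-1` _ = (@expi R : R -> R[i]^o) @^-1` A)%classic.
  by move/continuousP: continuous_expi; exact.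
by apply/funext => x; rewrite /preimage /= characterE.
Qed.

End circle_character.

Section polar.
Variable R : realType.

Lemma polar_form (z : R[i]) : exists phi : R,
  z = Complex (normc z * cos phi) (normc z * sin phi).
Proof.
have [->|z0] := eqVneq z 0.
  by exists 0; rewrite ComplexField.Normc.normc0 !mul0r.
have nz : normc z != 0 by apply: contra z0 => /eqP/ComplexField.Normc.eq0_normc ->.
have n0 : 0 < normc z by rewrite lt_neqAle eq_sym nz normc_ge0.
case: z z0 nz n0 => x y z0 nz n0; set r := normc _ in nz n0 *.
have r2 : r ^+ 2 = x ^+ 2 + y ^+ 2 by rewrite sqr_sqrtr// addr_ge0// sqr_ge0.
have xr : -1 <= x / r <= 1.
  rewrite -ler_norml normrM normfV (gtr0_norm n0) ler_pdivrMr// mul1r; exact: Re_le_normc (Complex x y).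
have cosE : cos (acos (x / r)) = x / r by rewrite acosK// in_itv.
have sinE : `|sin (acos (x / r))| = `|y| / r.
  rewrite sin_acos// ger0_norm ?sqrtr_ge0//.
  have -> : 1 - (x / r) ^+ 2 = (`|y| / r) ^+ 2.
    rewrite !expr_div_n real_normK ?num_real//.
    have -> : y ^+ 2 = r ^+ 2 - x ^+ 2 by rewrite r2; lra.
    by field.
  by rewrite sqrtr_sqr ger0_norm// divr_ge0// ltW.
have [s0|s0] : sin (acos (x / r)) = y / r \/ sin (- acos (x / r)) = y / r.
  have : `|sin (acos (x / r))| = `|y / r|.
    by rewrite sinE normrM normfV (gtr0_norm n0).
  move=> /eqP; rewrite eqr_norm2 => /orP[/eqP|/eqP h]; first by left.
  by right; rewrite sinN h opprK.
- by exists (acos (x / r)); rewrite cosE s0; congr Complex; rewrite mulrC divfK.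
- by exists (- acos (x / r)); rewrite cosN cosE s0; congr Complex; rewrite mulrC divfK.
Qed.

End polar.

Section principal_mahler.
Variables (R : realType) (f : laurent).

(** The monomial [z ^ b] has modulus 1 on the unit circle, so [f] and [F] have the same Mahler
    measure. *)
Lemma principal_mahler_le0 (b : int) (F : {poly int}) :
  (forall (V : zmodType) (v : int -> V),
      \sum_(m <- finsupp f) v m *~ f m = \sum_(i < size F) v (b + i%:Z) *~ F`_i) ->
  `|lead_coef F| = 1 ->
  (forall r, root (map_poly (intr : int -> R[i]) F) r -> normc r <= 1) ->
  (mahler_measure R f <= 0)%E.
Proof.
move=> fF F1 Froots; have := mahler_monic_le0 F1 Froots.
congr (is_true (_ <= _)%E); apply: eq_integral => t _; congr (lne _%:E).
have e0 : expi t != 0 :> R[i].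
  by apply: contra_eq_neq (normc_expi t) => ->; rewrite ComplexField.Normc.normc0 eq_sym oner_neq0.
have -> : laurent_eval f (expi t) = expi t ^ b * (map_poly (intr : int -> R[i]) F).[expi t].
  rewrite /laurent_eval; under eq_bigr do rewrite mulrzl.
  rewrite fF horner_coef size_map_inj_poly//; last exact: intr_inj.
  rewrite mulr_sumr; apply: eq_bigr => i _.
  by rewrite coef_map_id0// expfzDr// -exprnP mulrzl mulrzAr.
rewrite ComplexField.Normc.normcM.
suff -> : normc (expi t ^ b) = 1 by rewrite mul1r.
case: b {fF} => n; first by rewrite -exprnP normc_exp normc_expi expr1n.
by rewrite NegzE -exprnN ComplexField.Normc.normcV normc_exp normc_expi expr1n invr1.
Qed.

End principal_mahler.

Section correlation.
Variable R : realType.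

(** If the leading coefficient is a sign and all roots lie in the closed unit disc, the Mahler
    measure is at most 0, against the hypothesis; every other case has its own construction. *)
Lemma coherent_nonzero_mahler (f : laurent) (b : int) (F : {poly int}) (a phi : nat -> R)
    (M delta : R) :
  F != 0 ->
  (forall (V : zmodType) (v : int -> V),
      \sum_(m <- finsupp f) v m *~ f m = \sum_(i < size F) v (b + i%:Z) *~ F`_i) ->
  (0 < mahler_measure R f)%E ->
  (forall n, 0 <= a n <= M) -> 0 < delta ->
  frequently (fun N => delta * N%:R <= \sum_(n < N) a n) ->
  coherent F a phi.
Proof.
move=> F0 fF mf a0M delta0 a_freq.
have [F2|F2] := leP 2 `|lead_coef F|; first exact: coherent_lead_ge2 a0M delta0 a_freq F2.
have F1 : `|lead_coef F| = 1.
  by have : lead_coef F != 0; [rewrite lead_coef_eq0|move: F2; lia].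
have [[lam lam_root lam1]|small] := pselect (exists2 lam : R[i],
    root (map_poly (intr : int -> R[i]) F) lam & 1 < normc lam).
  exact: coherent_root a0M delta0 a_freq lam_root lam1.
suff : (mahler_measure R f <= 0)%E by move/(lt_le_trans mf); rewrite ltxx.
apply: principal_mahler_le0 fF F1 _ => r rr.
by rewrite leNgt; apply/negP => r1; apply: small; exists r.
Qed.

Lemma Re_rotate (z : R[i]) (phi x beta : R) :
  z = Complex (normc z * cos phi) (normc z * sin phi) ->
  complex.Re (Complex (cos beta) (sin beta) * (z * expi x)) =
    normc z * cos (2 * pi * x + phi + beta).
Proof.
move=> zE; rewrite {1}zE; set r := normc z; rewrite /expi /=.
by rewrite !cosD !sinD; ring.
Qed.

End correlation.

Theorem theorem2p1 (R : realType) (f : laurent)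
    (f_neq0 : f <> [fsfun with 0]) (mf_gt0 : (0 < mahler_measure R f)%E) :
  bohr_chaotic R (principal_action R f).
Proof.
move=> w [[M wM] /cesaro_limsup_gt0[delta delta0 w_freq]].
have [b [F [F0 fF]]] := laurent_poly f_neq0.
have [phi phiE] := choice (fun n => polar_form (w n)).
have wM' n : 0 <= normc (w n) <= M by rewrite normc_ge0 wM.
have [X [XZ [beta [c [c0 Xc]]]]] :=
  coherent_nonzero_mahler phi F0 fF mf_gt0 wM' delta0 w_freq.
pose x (n : int) : circle R := circle_pi (X n).
have xf : principal_set f x.
  move=> n; rewrite (fF _ (fun m => x (n + m))).
  have -> : \sum_(i < size F) x (n + (b + i%:Z)) *~ F`_i =
      circle_pi (\sum_(i < size F) (F`_i)%:~R * X (n + b + i%:Z)).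
    rewrite raddf_sum; apply: eq_bigr => i _.
    by rewrite mulrzl raddfMz addrA.
  exact/circle_pi_eq0/XZ.
exists (fun y : principal_set f => character (set_val y 0)).
exists (exist _ x (mem_set xf)); split.
  move=> y; apply: (@continuous_comp _ _ _
    (fun y : principal_set f => set_val y 0) (@character R)).
    apply: (@continuous_comp _ _ _ set_val (fun y : {ptws int -> circle R} => y 0)).
      exact: initial_continuous.
    exact: Pilot.Defs.coord_continuous.
  exact: continuous_character.
apply/cesaro_limsup_gt0; exists c => //.
apply: frequently_impl Xc => N /le_trans; apply.
(* Rotation by the angle [beta] preserves the modulus of the sum, which dominates the real part that
   coherence bounds from below. *)
pose u := Complex (cos beta) (sin beta).
set S := (X in _ <= normc X).
have uS : normc (u * S) = normc S.
  by rewrite ComplexField.Normc.normcM /= cos2Dsin2 sqrtr1 mul1r.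
rewrite -uS; apply: le_trans (le_trans (ler_norm _) (Re_le_normc _)).
rewrite mulr_sumr Re_sum; apply: ler_sum => n _.
by rewrite /= /x characterE add0r (Re_rotate _ _ (phiE n)).
Qed.
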